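(* Let $F$ be a C-function with $F(\beta_0)=1$ and $\mathfrak{L}_F$ positive definite. For $N,n,r\ge 0$, suppose $\phi_{N+n}\in\mathcal{L}_{N+n}\setminus\{0\}$ and $\phi_{N+n}\perp_F\mathcal{L}_{N+n-1}$, and let $\psi_{N+n}$ denote the rational function of the second kind of $\phi_{N+n}$. Suppose further that $A,B,C,D$ are self-reciprocal rational functions in $\mathcal{L}_N\cdot\tilde{\mathcal{L}}_r$ satisfying: $$\tau_A:=\frac{A^*(z)}{A(z)}=-\frac{B^*(z)}{B(z)}=-\frac{C^*(z)}{C(z)}=\frac{D^*(z)}{D(z)},\qquad \tau_A\in\mathbb{T};$$ $$B(\beta_j)\ne 0,\quad j=0,\ldots,N-1,\qquad\text{if } N>0;$$ $$(A-BF)(z)=\zeta_0(z)B_{N-1}(z)g(z)\quad\text{for some } g\in H(\mathbb{D});$$ $$(AD-BC)(z)=\zeta_0(z)B_{N-1}(z)f(z)\quad\text{for some } f\in H(\mathbb{D}).$$ Let $c_n\in\mathbb{R}\setminus\{0\}$. Then the rational functions $G_{r+n},H_{r+n},J_{r+n},K_{r+n}$ defined by $$\begin{pmatrix} G_{r+n}(z)&J_{r+n}(z)\\ H_{r+n}(z)&-K_{r+n}(z)\end{pmatrix}=\begin{pmatrix}\phi_{N+n}(z)&\psi_{N+n}(z)\\ \phi_{N+n}^*(z)&-\psi_{N+n}^*(z)\end{pmatrix}\begin{pmatrix}A(z)&C(z)\\ B(z)&D(z)\end{pmatrix}\{c_nP_N(z)B_N(z)\}^{-1}$$ are all in $\tilde{\mathcal{L}}_{r+n}$.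 Furthermore, $G_{r+n}^*(z)=\tau_AH_{r+n}(z)$ and $J_{r+n}^*(z)=\tau_AK_{r+n}(z)$.
   Context: Notation. $\mathbb{T}$ and $\mathbb{D}$ are the complex unit circle and open unit disc; $H(\mathbb{D})$ is the set of holomorphic functions on $\mathbb{D}$. The substar conjugate is $f_*(z)=\overline{f(1/\overline z)}$. For any sequence of points $\beta_0,\beta_1,\ldots$ in $\mathbb{D}$ put $\varpi_k(z)=1-\overline{\beta_k}z$, $\varpi_k^*(z)=z-\beta_k$, $\eta_k=\overline{\beta_k}/|\beta_k|$ if $\beta_k\neq0$ and $\eta_k=1$ if $\beta_k=0$, $\zeta_k=\eta_k\varpi_k^*/\varpi_k$, $B_{-1}=1/\zeta_0$, and $B_k=B_{k-1}\zeta_k$ for $k\ge0$ (so $B_0=1$, $B_k=\zeta_1\cdots\zeta_k$). The associated spaces are $\mathcal{L}_{-1}=\{0\}$, $\mathcal{L}_0=\mathbb{C}$, $\mathcal{L}_k=\mathcal{L}\{\beta_1,\ldots,\beta_k\}=\{p/(\varpi_1\cdots\varpi_k): p \text{ a polynomial of degree}\le k\}$, and $\mathcal{L}=\bigcup_k\mathcal{L}_k$. Three families of points in $\mathbb{D}$ are given: $\beta_0,\ldots,\beta_N$; $\hat\beta_0,\hat\beta_1,\hat\beta_2,\ldots$ with $\hat\beta_0=\beta_N$; and $\tilde\beta_0,\ldots,\tilde\beta_r$. Hats and tildes over $\zeta,B,\mathcal{L}$ mean that these are built from the corresponding family. The first family is continued by $\beta_{N+j}:=\hat\beta_j$ ($j\ge1$),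 so that $B_{N+n}=B_N\hat B_n$ and $\mathcal{L}_{N+n}=\mathcal{L}\{\beta_1,\ldots,\beta_N,\hat\beta_1,\ldots,\hat\beta_n\}=\mathcal{L}_N\cdot\hat{\mathcal{L}}_n$; and $\mathcal{L}_{N+n-1}=\mathcal{L}_N\cdot\hat{\mathcal{L}}_{n-1}$ if $n>0$, $=\mathcal{L}_{N-1}$ if $n=0$. Likewise $\tilde{\mathcal{L}}_{r+n}=\mathcal{L}\{\tilde\beta_1,\ldots,\tilde\beta_r,\hat\beta_1,\ldots,\hat\beta_n\}=\tilde{\mathcal{L}}_r\cdot\hat{\mathcal{L}}_n$. Superstar: for a function $f$ regarded as an element of one of these spaces, $f^*=\mathbf{B}f_*$ where $\mathbf B$ is the Blaschke product of the space: $\mathbf B=B_{N+n}$ for $\mathcal{L}_{N+n}$, $\mathbf B=B_N\tilde B_r$ for $\mathcal{L}_N\cdot\tilde{\mathcal{L}}_r$, $\mathbf B=\tilde B_r\hat B_n$ for $\tilde{\mathcal{L}}_{r+n}$. Self-reciprocal means $f^*=kf$ for some constant $k\in\mathbb{C}$. A C-function is an $F\in H(\mathbb{D})$ with $\Re F(z)>0$ on $\mathbb{D}$. Put $D_0(t,z)=\dfrac{\zeta_0(t)+\zeta_0(z)}{\zeta_0(t)-\zeta_0(z)}$ (Riesz–Herglotz kernel). To a C-function $F$ with $F(\beta_0)=1$ corresponds the probability measure $\mu$ on $\mathbb{T}$ with $F(z)=\int_{\mathbb{T}}D_0(t,z)\,d\mu(t)$, and $\mathfrak{L}_F\{f\}=\int_{\mathbb{T}}f\,d\mu$;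 positive definite means $\mathfrak{L}_F\{ff_*\}>0$ for all $f\in\mathcal{L}\setminus\{0\}$. $f\perp_Fg$ means $\mathfrak{L}_F\{fg_*\}=0$. The function of the second kind of $\phi_k$ is $\psi_k(z)=\mathfrak{L}_F\{D_0(t,z)[\phi_k(t)-\phi_k(z)]\}+\mathfrak{L}_F\{\phi_k(t)\}$ ($\mathfrak{L}_F$ acting on $t$). $P_N(z)=\dfrac{\varpi_N(\beta_N)\,\varpi_0(z)\varpi_0^*(z)}{\varpi_0(\beta_0)\,\varpi_N(z)\varpi_N^*(z)}$. *)

(* Defs.v *)
From HB Require Import structures.
From mathcomp Require Import all_boot all_order all_algebra.
From mathcomp Require Import all_classical all_reals all_analysis.
From mathcomp Require Import complex.
Set Implicit Arguments.
Unset Strict Implicit.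
Unset Printing Implicit Defensive.
Import Order.TTheory GRing.Theory Num.Theory numFieldNormedType.Exports.
Local Open Scope classical_set_scope.
Local Open Scope ring_scope.

Notation ratfun R := {fraction {poly R[i]}}.
Notation toratfun := (@FracField.tofrac {poly _[i]}).

Definition unit_disc (R : realType) : set R[i] := [set z | `|z| < 1].
Definition unit_circle (R : realType) : set R[i] := [set z | `|z| = 1].

Definition holomorphic_on_disc (R : realType) (f : R[i] -> R[i]) : Prop :=
  forall z, unit_disc z -> derivable (f : R[i]^o -> R[i]^o) z 1.

Definition C_function (R : realType) (F : R[i] -> R[i]) : Prop :=
  holomorphic_on_disc F /\ (forall z, unit_disc z -> 0 < complex.Re (F z)).

Definition ratconst (R : realType) (c : R[i]) : ratfun R := toratfun c%:P.

(* The numerator and denominator of the chosen representative need not be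
   coprime, so common factors are cancelled first: this is the value of the
   rational function at every z that is not a pole (0 at a pole). *)
Definition ratval (R : realType) (f : ratfun R) (z : R[i]) : R[i] :=
  let p := (frac (generic_quotient.repr f)).1 in let q := (frac (generic_quotient.repr f)).2 in
  (p %/ gcdp p q).[z] / (q %/ gcdp p q).[z].

Definition polystar (R : realType) (p : {poly R[i]}) : ratfun R :=
  (map_poly (fun c : R[i] => ratconst (c^*)%C) p).[(toratfun 'X)^-1].

(* f_*(z) = conj (f (1 / conj z)): conjugate the coefficients and substitute
   1 / z for z. *)
Definition substar (R : realType) (f : ratfun R) : ratfun R :=
  polystar (frac (generic_quotient.repr f)).1 / polystar (frac (generic_quotient.repr f)).2.

Definition superstar (R : realType) (B f : ratfun R) : ratfun R :=
  B * substar f.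

Definition self_reciprocal (R : realType) (B f : ratfun R) : Prop :=
  exists k : R[i], superstar B f = ratconst k * f.

Section Blaschke.
Variable R : realType.
Implicit Types (b : R[i]) (beta : nat -> R[i]).

Definition varpi b : ratfun R := toratfun (1 - (b^*)%C *: 'X).
Definition varpis b : ratfun R := toratfun ('X - b%:P).
Definition eta b : R[i] := if b == 0 then 1 else (b^*)%C / `|b|.
Definition zeta b : ratfun R := ratconst (eta b) * varpis b / varpi b.

(* Only the index -1 is relevant among the negative ones. *)
Definition blaschke beta (k : int) : ratfun R :=
  match k with
  | Posz m => \prod_(1 <= i < m.+1) zeta (beta i)
  | Negz _ => (zeta (beta 0%N))^-1
  end.

(* The products of an element of ratspace s and one of ratspace t form
   ratspace (s ++ t): numerators factor, R[i] being algebraically closed. *)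
Definition ratspace (s : seq R[i]) : set (ratfun R) :=
  [set f | exists2 p : {poly R[i]}, (size p <= (size s).+1)%N &
           f = toratfun p / \prod_(b <- s) varpi b].

(* beta_1, ..., beta_k *)
Definition points beta (k : nat) : seq R[i] := [seq beta i | i <- iota 1 k].

(* L_k, with L_(-1) = {0}. *)
Definition nested_space beta (k : int) : set (ratfun R) :=
  match k with
  | Posz m => ratspace (points beta m)
  | Negz _ => [set 0]
  end.

Definition continue_points beta (N : nat) (hbeta : nat -> R[i]) (k : nat) :
  R[i] := if (k <= N)%N then beta k else hbeta (k - N)%N.

Definition PN beta (N : nat) : ratfun R :=
  ratconst (ratval (varpi (beta N)) (beta N))
    * varpi (beta 0%N) * varpis (beta 0%N)
  / (ratconst (ratval (varpi (beta 0%N)) (beta 0%N))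
    * varpi (beta N) * varpis (beta N)).

End Blaschke.

(* R[i] with its Borel sigma-algebra. *)
Definition borelC (R : realType) : measurableType _ :=
  g_sigma_algebraType (@open R[i]^o).

Section Measure.
Variables (R : realType) (mu : probability (borelC R) R).

Definition circle_int (f : R[i] -> R[i]) : R[i] :=
  Complex (\int[mu]_(t in (@unit_circle R : set (borelC R))) complex.Re (f t))
          (\int[mu]_(t in (@unit_circle R : set (borelC R))) complex.Im (f t)).

Definition LF (f : ratfun R) : R[i] := circle_int (ratval f).

Definition positive_definite (beta : nat -> R[i]) : Prop :=
  forall (k : nat) (f : ratfun R),
    nested_space beta k f -> f != 0 -> 0 < LF (f * substar f).

Definition orthogonal_to (f : ratfun R) (V : set (ratfun R)) : Prop :=
  forall g, V g -> LF (f * substar g) = 0.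

Definition D0 (b0 t z : R[i]) : R[i] :=
  (ratval (zeta b0) t + ratval (zeta b0) z)
  / (ratval (zeta b0) t - ratval (zeta b0) z).

(* mu is carried by the unit circle and F is its Riesz-Herglotz transform. *)
Definition Riesz_Herglotz (b0 : R[i]) (F : R[i] -> R[i]) : Prop :=
  mu (@unit_circle R) = 1%E /\
  forall z, unit_disc z -> F z = circle_int (fun t => D0 b0 t z).

(* For fixed z in the disc the integrand has no singularity on the circle; these
   values on the disc determine the rational function psi. *)
Definition second_kind (b0 : R[i]) (phi psi : ratfun R) : Prop :=
  forall z, unit_disc z ->
    ratval psi z =
    circle_int (fun t => D0 b0 t z * (ratval phi t - ratval phi z)) + LF phi.

End Measure.

Definition mx22 (K : Type) (a b c d : K) : 'M[K]_2 :=
  \matrix_(i < 2, j < 2)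
    if i == 0 then (if j == 0 then a else b) else (if j == 0 then c else d).

(* Main.v *)
Require Import Defs.
From HB Require Import structures.
From mathcomp Require Import all_boot all_order all_algebra.
From mathcomp Require Import all_classical all_reals all_analysis.
From mathcomp Require Import complex.
From mathcomp Require Import ring generic_quotient qpoly measurable_realfun.
Set Implicit Arguments.
Unset Strict Implicit.
Unset Printing Implicit Defensive.
Import Order.TTheory GRing.Theory Num.Theory numFieldNormedType.Exports.
Local Open Scope classical_set_scope.
Local Open Scope ring_scope.

(** Put m = N + n, let beta_0, beta_1, ... be the continued sequence and let
    Z = (X - beta_0) ... (X - beta_(N-1)).  The numerators of phi A + psi B and of
    the three other entries of the matrix product are polynomials of degree at
    most m + N + r.  Dividing by c_n P_N B_N removes from such a numerator the
    factor Z and the factor W = (1 - conj beta_0 X) ... (1 - conj beta_(N-1) X),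
    and cancels the two copies of varpi_1 ... varpi_N in the denominator
    ([PN_blaschke]); so everything reduces to the divisibility of the four
    numerators by Z W.

    Divisibility by Z is interpolation.  On the disc, phi F + psi is the integral
    of phi (t) (D_0(t,z) + 1), and orthogonality makes it a multiple of
    (z - beta_0) ... (z - beta_(m-1)) ([orthogonal_transform_bigO]).  Evaluating
    psi outside the disc, its superstar conjugate gives for phi^* F - psi^* the
    factor (z - beta_0) ... (z - beta_m) ([reflected_transform_bigO]).  As A - B F
    is also divisible by Z in the disc, so are
    phi A + psi B = phi (A - B F) + B (phi F + psi) and its conjugate
    phi^* A - psi^* B; the entries with C and D follow from the hypotheses on
    A D - B C and on the values of B ([numerators_dvd]).  Since only orders of
    vanishing of polynomials are wanted, the cofactors need not be holomorphic:
    it is enough that they be locally bounded ([bigO_dvd]).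

    Divisibility by W is reciprocity.  Because A, D and B, C are self-reciprocal
    with opposite ratios, the conjugate reversal of a numerator is a constant
    times the numerator below or above it in the matrix, hence a multiple of Z;
    reversing back turns Z into W ([zeros_poles_factor]).

    The identities between G, H, J, K only use that the substar conjugation is a
    field morphism which inverts Blaschke products and fixes c_n P_N
    ([superstar_transform]). *)

(** * Values and substar conjugates of rational functions *)

Section RationalFunctions.
Variable R : realType.
Implicit Types (p q P Q : {poly R[i]}) (f g : ratfun R) (z w c b : R[i]).
Local Notation num f := (frac (generic_quotient.repr f)).1.
Local Notation den f := (frac (generic_quotient.repr f)).2.

(** Values and conjugates are defined from a chosen representative; this fact,
    together with cross-multiplication, makes them computable from any other. *)
Lemma repr_fraction f : f = toratfun (num f) / toratfun (den f).
Proof.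
have d0 : toratfun (den f) != 0 by rewrite tofrac_eq0; exact: denom_ratioP.
apply: (mulIf d0); rewrite divfK // -{1}[f]reprK; move: (generic_quotient.repr f) => x.
unlock FracField.tofrac; rewrite -[LHS]FracField.pi_mul; apply/eqmodP/eqP => /=.
by rewrite !numden_Ratio ?(oner_eq0, mul1r, mulr1) ?denom_ratioP // mulrC.
Qed.

Lemma eq_fraction p q P Q : q != 0 -> Q != 0 ->
  toratfun p / toratfun q = toratfun P / toratfun Q <-> p * Q = P * q.
Proof.
move=> q0 Q0; split.
  move/eqP; rewrite eqr_div ?tofrac_eq0// -!tofracM tofrac_eq => /eqP ->.
  by rewrite mulrC.
by move=> e; apply/eqP; rewrite eqr_div ?tofrac_eq0// -!tofracM e.
Qed.

(** Let P/Q be the chosen representative and d = gcd (P, Q).  Since P/d and Q/d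
    are coprime and (P/d) q = p (Q/d), the polynomial Q/d divides q, so it does
    not vanish at z either. *)
Lemma ratval_fraction p q z : q.[z] != 0 ->
  ratval (toratfun p / toratfun q) z = p.[z] / q.[z].
Proof.
move=> qz0; have q0 : q != 0 by apply: contraNneq qz0 => ->; rewrite horner0.
set f := toratfun p / _; rewrite /ratval.
have := repr_fraction f; have := denom_ratioP (generic_quotient.repr f).
set P := num f; set Q := den f => Q0 /esym /(eq_fraction P p Q0 q0) e.
set d := gcdp P Q; have d0 : d != 0 by rewrite gcdp_eq0 negb_and Q0 orbT.
have eP : P %/ d * d = P by rewrite divpK ?dvdp_gcdl.
have eQ : Q %/ d * d = Q by rewrite divpK ?dvdp_gcdr.
have e1 : P %/ d * q = p * (Q %/ d).
  by apply: (mulIf d0); rewrite mulrAC eP e -eQ mulrA eQ.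
have dv : Q %/ d %| q.
  rewrite -(@Gauss_dvdpr _ _ (P %/ d)); first by rewrite e1 dvdp_mull.
  by rewrite coprimep_sym coprimep_div_gcd // Q0 orbT.
have Qz : (Q %/ d).[z] != 0.
  apply: contraNneq qz0 => Qz; rewrite -(divpK dv) hornerM Qz mulr0 //.
by apply/eqP; rewrite eqr_div // -!hornerM e1.
Qed.

(** The coefficient map of [polystar], named so that it can be given its ring
    morphism structure. *)
Definition conjconst c : ratfun R := ratconst (c^*)%C.

Fact conjconst_is_zmod_morphism : zmod_morphism conjconst.
Proof. by move=> x y; rewrite /conjconst /ratconst rmorphB polyCB tofracB. Qed.
Fact conjconst_is_monoid_morphism : monoid_morphism conjconst.
Proof.
split; first by rewrite /conjconst /ratconst rmorph1 polyC1 tofrac1.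
by move=> x y; rewrite /conjconst /ratconst rmorphM polyCM tofracM.
Qed.
HB.instance Definition _ := GRing.isZmodMorphism.Build _ _ conjconst
  conjconst_is_zmod_morphism.
HB.instance Definition _ := GRing.isMonoidMorphism.Build _ _ conjconst
  conjconst_is_monoid_morphism.

Lemma polystarE p : polystar p = (map_poly conjconst p).[(toratfun 'X)^-1].
Proof. by []. Qed.

Lemma polystarM p q : polystar (p * q) = polystar p * polystar q.
Proof. by rewrite !polystarE rmorphM hornerM. Qed.
Lemma polystarD p q : polystar (p + q) = polystar p + polystar q.
Proof. by rewrite !polystarE rmorphD hornerD. Qed.
Lemma polystarN p : polystar (- p) = - polystar p.
Proof. by rewrite !polystarE rmorphN hornerN. Qed.
Lemma polystarC c : polystar c%:P = ratconst (c^*)%C.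
Proof. by rewrite !polystarE map_polyC hornerC. Qed.
Lemma polystarX : polystar ('X : {poly R[i]}) = (toratfun 'X)^-1.
Proof. by rewrite !polystarE map_polyX hornerX. Qed.

Lemma ratconstM c d : ratconst (c * d) = ratconst c * ratconst d.
Proof. by rewrite /ratconst polyCM tofracM. Qed.
Lemma ratconst_neq0 c : c != 0 -> ratconst c != 0.
Proof. by rewrite /ratconst tofrac_eq0 polyC_eq0. Qed.
Lemma ratconst1 : ratconst 1 = 1 :> ratfun R.
Proof. by rewrite /ratconst polyC1 tofrac1. Qed.
Lemma ratconstV c : ratconst c^-1 = (ratconst c)^-1.
Proof.
have [->|c0] := eqVneq c 0.
  by rewrite invr0 /ratconst polyC0 tofrac0 invr0.
apply: (mulfI (ratconst_neq0 c0)); rewrite mulfV ?ratconst_neq0//.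
by rewrite -ratconstM mulfV // ratconst1.
Qed.

(** For z <> 0 this is z^k times the conjugate of p (1 / conj z): up to a
    constant, the numerator of the superstar conjugate of a function with
    numerator p.  Taking k instead of the degree of p keeps the operation
    additive. *)
Definition reversal k p : {poly R[i]} := \poly_(i < k.+1) (p`_(k - i))^*%C.

Lemma size_reversal k p : (size (reversal k p) <= k.+1)%N.
Proof. exact: size_poly. Qed.

Lemma reversalK k p : (size p <= k.+1)%N -> reversal k (reversal k p) = p.
Proof.
move=> sp; apply/polyP => i; rewrite !coef_poly; case: ltnP => ik.
  by rewrite ltnS leq_subr subKn ?conjcK.
by rewrite nth_default // (leq_trans sp).
Qed.

Lemma polystar_reversal k p : (size p <= k.+1)%N ->
  polystar p = toratfun (reversal k p) / toratfun ('X^k).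
Proof.
move=> sp; have X0 : toratfun ('X : {poly R[i]}) != 0 by rewrite tofrac_eq0 polyX_eq0.
rewrite polystarE (horner_coef_wide _ (leq_trans (size_poly _ _) sp)).
rewrite [reversal k p]poly_def rmorph_sum /= mulr_suml.
rewrite [RHS](reindex_inj rev_ord_inj) /=; apply: eq_bigr => i _.
have ik : (i <= k)%N by rewrite -ltnS.
rewrite coef_map subSS subKn // -mul_polyC tofracM !tofracXn.
rewrite -mulrA; congr (_ * _).
apply: (mulIf (expf_neq0 k X0)); rewrite divfK ?expf_neq0//.
by rewrite -[in X in _ * X = _](@subnK i k)// exprD mulrCA -exprMn mulVf // expr1n mulr1.
Qed.

Lemma polystar_neq0 p : p != 0 -> polystar p != 0.
Proof.
move=> p0; have sp : (size p <= (size p).-1.+1)%N by rewrite leqSpred.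
rewrite (polystar_reversal sp) mulf_neq0 ?invr_eq0 ?tofrac_eq0 ?expf_neq0 ?polyX_eq0//.
by apply: contraNneq p0 => e; rewrite -(reversalK sp) e /reversal;
  apply/eqP/polyP => i; rewrite coef_poly !coef0 conjc0 if_same.
Qed.

Lemma reversalM k l p q : (size p <= k.+1)%N -> (size q <= l.+1)%N ->
  reversal (k + l) (p * q) = reversal k p * reversal l q.
Proof.
move=> sp sq; have spq : (size (p * q)%R <= (k + l).+1)%N.
  rewrite (leq_trans (size_polyMleq _ _)) // -subn1 leq_subLR.
  by apply: leq_trans (leq_add sp sq) _; rewrite addnS addSn.
have := polystarM p q.
rewrite (polystar_reversal sp) (polystar_reversal sq) (polystar_reversal spq).
have Xn0 n : ('X^n : {poly R[i]}) != 0 by rewrite expf_neq0 ?polyX_eq0.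
rewrite mulf_div -!tofracM -exprD; move/(eq_fraction _ _ (Xn0 _) (Xn0 _)).
by move/(mulIf (Xn0 _)).
Qed.

Lemma reversalD k p q : reversal k (p + q) = reversal k p + reversal k q.
Proof.
by apply/polyP => i; rewrite coefD !coef_poly; case: ifP; rewrite ?addr0// coefD rmorphD.
Qed.
Lemma reversalN k p : reversal k (- p) = - reversal k p.
Proof.
by apply/polyP => i; rewrite coefN !coef_poly; case: ifP; rewrite ?oppr0// coefN rmorphN.
Qed.
Lemma horner_reversal k p z : (size p <= k.+1)%N -> z != 0 ->
  (reversal k p).[z] = z ^+ k * (p.[(z^*)%C^-1])^*%C.
Proof.
move=> sp z0; rewrite (horner_coef_wide _ sp) rmorph_sum mulr_sumr.
rewrite (horner_coef_wide _ (size_reversal k p)).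
rewrite [LHS](reindex_inj rev_ord_inj) /=; apply: eq_bigr => i _.
have ik : (i <= k)%N by rewrite -ltnS.
rewrite coef_poly subSS ltnS leq_subr subKn // rmorphM rmorphXn /=.
rewrite conjc_inv conjcK mulrCA; congr (_ * _).
by rewrite -[X in _ = z ^+ X * _](@subnK i k)// exprD -mulrA -exprMn mulfV // expr1n mulr1.
Qed.

Lemma substar_fraction p q : q != 0 ->
  substar (toratfun p / toratfun q) = polystar p / polystar q.
Proof.
move=> q0; set f := toratfun p / _; rewrite /substar.
have := repr_fraction f; have := denom_ratioP (generic_quotient.repr f).
set P := num f; set Q := den f => Q0 /esym /(eq_fraction P p Q0 q0) e.
by apply/eqP; rewrite eqr_div ?polystar_neq0// -!polystarM e mulrC.
Qed.

Lemma fraction_ind (K : ratfun R -> Prop) :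
  (forall p q, q != 0 -> K (toratfun p / toratfun q)) -> forall f, K f.
Proof. by move=> h f; rewrite (repr_fraction f); apply: h; exact: denom_ratioP. Qed.

Lemma substarM f g : substar (f * g) = substar f * substar g.
Proof.
elim/fraction_ind: f => p q q0; elim/fraction_ind: g => P Q Q0.
rewrite mulf_div -!tofracM !substar_fraction ?mulf_neq0// !polystarM.
by rewrite mulf_div.
Qed.

Lemma substarD f g : substar (f + g) = substar f + substar g.
Proof.
elim/fraction_ind: f => p q q0; elim/fraction_ind: g => P Q Q0.
rewrite addf_div ?tofrac_eq0// -!tofracM -tofracD !substar_fraction ?mulf_neq0//.
by rewrite polystarD !polystarM addf_div ?polystar_neq0.
Qed.

Lemma substar_poly p : substar (toratfun p) = polystar p.
Proof.
have -> : toratfun p = toratfun p / toratfun 1 by rewrite tofrac1 divr1.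
by rewrite substar_fraction ?oner_neq0// polystarC conjc1 ratconst1 divr1.
Qed.

Lemma substar0 : substar 0 = 0 :> ratfun R.
Proof. by rewrite -[X in substar X]tofrac0 substar_poly polystarC conjc0 /ratconst tofrac0. Qed.

Lemma substar_ratconst c : substar (ratconst c) = ratconst (c^*)%C.
Proof. by rewrite substar_poly polystarC. Qed.

Lemma substarV f : substar f^-1 = (substar f)^-1.
Proof.
elim/fraction_ind: f => p q q0; have [->|p0] := eqVneq p 0.
  by rewrite tofrac0 mul0r invr0 substar0 invr0.
by rewrite invf_div !substar_fraction // invf_div.
Qed.

End RationalFunctions.

(** * Integration over the unit circle *)

Section CircleIntegral.
Variables (R : realType) (mu : probability (borelC R) R).
Local Notation T := (@unit_circle R : set (borelC R)).
Implicit Types (f g : R[i] -> R[i]) (z w c : R[i]).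

Lemma measurable_circle : measurable T.
Proof.
rewrite -[T]setCK; apply: measurableC; apply: sub_sigma_algebra.
have -> : ~` (@unit_circle R) = (fun z : R[i]^o => `|z|) @^-1` (~` [set (1 : R[i]^o)]).
  by [].
apply: open_comp => [z _|]; first exact: norm_continuous.
rewrite openC; apply: accessible_closed_set1.
exact/hausdorff_accessible/norm_hausdorff.
Qed.

(** A 1-Lipschitz function is continuous, so it pulls open intervals back to
    generators of the Borel sigma-algebra. *)
Lemma measurable_of_1Lipschitz (h : R[i] -> R) :
  (forall x y, (`|h x - h y|%:C)%C <= `|x - y|) ->
  measurable_fun T (h : borelC R -> R).
Proof.
move=> hl; apply: (measurability _ (RGenOpens.measurableE R)).
move=> _ [_ [a [b ->] <-]]; apply: measurableI; first exact: measurable_circle.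
apply: sub_sigma_algebra; apply: (@open_comp R[i]^o R^o); last exact: interval_open.
move=> x _; apply/(@cvgrPdist_lt R R^o _ (nbhs (x : R[i]^o)) (nbhs_filter _)) => e e0.
near=> y.
rewrite -ltcR (le_lt_trans (hl _ _))//; near: y.
by apply: (@nbhsx_ballx _ R[i]^o x (e%:C)%C); rewrite ltcR.
Unshelve. all: by end_near. Qed.

Lemma measurable_Re : measurable_fun T (@complex.Re R : borelC R -> R).
Proof.
by apply: measurable_of_1Lipschitz => x y; rewrite -raddfB; exact: normc_ge_Re.
Qed.

Lemma normc_ge_Im z : (`|complex.Im z|%:C)%C <= `|z|.
Proof.
have := normc_ge_Re (z * 'i%C); rewrite ReiNIm normrN normrM.
by have -> : `|'i%C : R[i]| = 1;
  rewrite ?mulr1// normc_def /= expr0n add0r expr1n sqrtr1.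
Qed.

Lemma measurable_Im : measurable_fun T (@complex.Im R : borelC R -> R).
Proof.
by apply: measurable_of_1Lipschitz => x y; rewrite -raddfB; exact: normc_ge_Im.
Qed.

Lemma eq_measurable_circle (h k : borelC R -> R) : (forall t, h t = k t) ->
  measurable_fun T h -> measurable_fun T k.
Proof. by move=> /funext ->. Qed.

(** On nonnegative reals, inversion is the power function of exponent -1. *)
Lemma measurable_circle_inv (h : borelC R -> R) : (forall t, T t -> 0 <= h t) ->
  measurable_fun T h -> measurable_fun T (fun t => (h t)^-1).
Proof.
move=> h0 mh; apply: (@eq_measurable_fun _ _ _ _ _ (fun t => h t `^ (-1))).
  by move=> t /set_mem /h0 /powR_inv1.
exact: (measurableT_comp (measurable_powR _)).
Qed.

(** Measurability and boundedness are preserved by sums, products and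
    conjugation, and by inversion away from zero; so this class contains every
    rational function without pole on the circle, and all its members are
    integrable. *)
Definition regular_on_circle f : Prop :=
  [/\ measurable_fun T (fun t : borelC R => complex.Re (f t)),
      measurable_fun T (fun t : borelC R => complex.Im (f t)) &
      exists M : R[i], forall t, `|t| = 1 -> `|f t| <= M].

Lemma eq_regular f g : (forall t, `|t| = 1 -> f t = g t) ->
  regular_on_circle f -> regular_on_circle g.
Proof.
move=> fg [mr mi [M hM]]; split.
- by apply: eq_measurable_fun mr => t /set_mem tT; rewrite fg.
- by apply: eq_measurable_fun mi => t /set_mem tT; rewrite fg.
- by exists M => t t1; rewrite -fg // hM.
Qed.

Lemma regular_cst c : regular_on_circle (fun=> c).
Proof. by split; [exact: measurable_cst|exact: measurable_cst|exists `|c|]. Qed.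

Lemma regular_id : regular_on_circle id.
Proof.
by split; [exact: measurable_Re|exact: measurable_Im|exists 1 => t ->].
Qed.

Lemma regularD f g : regular_on_circle f -> regular_on_circle g ->
  regular_on_circle (fun t => f t + g t).
Proof.
move=> [fr fi [M hM]] [gr gi [K hK]]; split.
- apply: eq_measurable_circle (measurable_funD fr gr) => t.
  by rewrite /=; case: (f t) => ? ?; case: (g t).
- apply: eq_measurable_circle (measurable_funD fi gi) => t.
  by rewrite /=; case: (f t) => ? ?; case: (g t).
- by exists (M + K) => t t1; rewrite (le_trans (ler_normD _ _))// lerD ?hM ?hK.
Qed.

Lemma regularM f g : regular_on_circle f -> regular_on_circle g ->
  regular_on_circle (fun t => f t * g t).
Proof.
move=> [fr fi [M hM]] [gr gi [K hK]]; split.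
- apply: eq_measurable_circle (measurable_funB (measurable_funM fr gr)
    (measurable_funM fi gi)) => t.
  by rewrite /=; case: (f t) => ? ?; case: (g t).
- apply: eq_measurable_circle (measurable_funD (measurable_funM fr gi)
    (measurable_funM fi gr)) => t.
  by rewrite /=; case: (f t) => ? ?; case: (g t).
- by exists (M * K) => t t1; rewrite normrM ler_pM ?hM ?hK.
Qed.

Lemma regular_conj f : regular_on_circle f -> regular_on_circle (fun t => (f t)^*%C).
Proof.
move=> [fr fi [M hM]]; split.
- by apply: eq_measurable_circle fr => t; case: (f t).
- by apply: eq_measurable_circle (measurable_funN fi) => t /=; case: (f t).
- by exists M => t t1; rewrite normcJ hM.
Qed.

Lemma regularV f (d : R[i]) : 0 < d -> (forall t, `|t| = 1 -> d <= `|f t|) ->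
  regular_on_circle f -> regular_on_circle (fun t => (f t)^-1).
Proof.
move=> d0 hd rf.
have [] := regularM rf (regular_conj rf).
set n2 := fun t => f t * (f t)^*%C => mn _ _.
have n2E t : n2 t = ((complex.Re (n2 t))%:C)%C.
  rewrite /n2; case: (f t) => a b; apply/eqP; rewrite eq_complex /= eqxx /=.
  by apply/eqP; ring.
have n2_ge0 t : 0 <= complex.Re (n2 t).
  by rewrite -ler0c -n2E /n2 -sqr_normc exprn_ge0.
have mV := measurable_circle_inv (fun t _ => n2_ge0 t) mn.
have [cr ci _] := regular_conj rf.
have E t : (f t)^-1 = ((complex.Re (n2 t))^-1%:C)%C * (f t)^*%C.
  have -> : ((complex.Re (n2 t))^-1%:C)%C = (n2 t)^-1.
    by rewrite [in RHS]n2E; exact: fmorphV.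
  by rewrite /n2 -sqr_normc -invc_norm.
split.
- apply: eq_measurable_circle (measurable_funM mV cr) => t.
  by rewrite /= E; case: (f t)^*%C => a b /=; rewrite mul0r subr0.
- apply: eq_measurable_circle (measurable_funM mV ci) => t.
  by rewrite /= E; case: (f t)^*%C => a b /=; rewrite mul0r addr0.
- exists d^-1 => t t1; rewrite normfV lef_pV2 ?posrE ?hd//.
  exact: lt_le_trans (hd _ t1).
Qed.

Lemma regular_poly (p : {poly R[i]}) : regular_on_circle (fun t => p.[t]).
Proof.
elim/poly_ind: p => [|p c rp].
  by apply: eq_regular (regular_cst 0) => t _; rewrite horner0.
apply: (eq_regular _ (regularD (regularM rp regular_id) (regular_cst c))) => t _.
by rewrite hornerMXaddC.
Qed.

Lemma regular_inv_sub z : `|z| != 1 -> regular_on_circle (fun t => (t - z)^-1).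
Proof.
move=> z1; apply: (@regularV _ `| `|z| - 1|); first by rewrite normr_gt0 subr_eq0.
  by move=> t t1; rewrite -t1 distrC ler_dist_dist.
exact: regularD regular_id (regular_cst (- z)).
Qed.

Lemma regular_sum (I : Type) (s : seq I) (F : I -> R[i] -> R[i]) :
  (forall i, regular_on_circle (F i)) -> regular_on_circle (fun t => \sum_(i <- s) F i t).
Proof.
move=> rF; elim: s => [|i s IH].
  by apply: eq_regular (regular_cst 0) => t _; rewrite big_nil.
by apply: eq_regular (regularD (rF i) IH) => t _; rewrite big_cons.
Qed.

Lemma regular_integrable f : regular_on_circle f ->
  mu.-integrable T (EFin \o (fun t : borelC R => complex.Re (f t))) /\
  mu.-integrable T (EFin \o (fun t : borelC R => complex.Im (f t))).
Proof.
move=> [fr fi [M hM]].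
have muT : (mu T < +oo)%E.
  by rewrite (le_lt_trans (probability_le1 mu measurable_circle)) ?ltry.
have b (h : R[i] -> R) : (forall x, (`|h x|%:C)%C <= `|x|) ->
    [bounded (h (f t) : R^o) | t in T].
  move=> hh; exists (complex.Re M); split; first exact: num_real.
  move=> x Mx t Tt; apply: le_trans (ltW Mx).
  by have := le_trans (hh (f t)) (hM t Tt); rewrite lecE => /andP[].
split; apply: measurable_bounded_integrable => //; try exact: measurable_circle.
- by apply: b => x; exact: normc_ge_Re.
- by apply: b => x; exact: normc_ge_Im.
Qed.

Local Notation int := (circle_int mu).

Lemma eq_circle_int f g : (forall t, `|t| = 1 -> f t = g t) -> int f = int g.
Proof.
by move=> fg; congr Complex; apply: eq_Rintegral => t /set_mem /fg ->.
Qed.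

Lemma circle_intD f g : regular_on_circle f -> regular_on_circle g ->
  int (fun t => f t + g t) = int f + int g.
Proof.
move=> /regular_integrable[fr fi] /regular_integrable[gr gi].
have mT := measurable_circle.
apply/eqP; rewrite eq_complex /=; apply/andP; split; apply/eqP.
  by rewrite -RintegralD//; apply: eq_Rintegral => t _; rewrite raddfD.
by rewrite -RintegralD//; apply: eq_Rintegral => t _; rewrite raddfD.
Qed.

Lemma circle_intZ c f : regular_on_circle f ->
  int (fun t => c * f t) = c * int f.
Proof.
move=> /regular_integrable[fr fi].
have mT := measurable_circle; case: c => a b.
have i1 (x : R) := integrableZl mT x fr.
have i2 (x : R) := integrableZl mT x fi.
apply/eqP; rewrite eq_complex /=; apply/andP; split; apply/eqP.
  rewrite -!RintegralZl// -RintegralB //; [|exact: i1|exact: i2].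
  by apply: eq_Rintegral => t _; case: (f t).
rewrite -!RintegralZl// -RintegralD //; [|exact: i2|exact: i1].
by apply: eq_Rintegral => t _; case: (f t).
Qed.

Lemma circle_intB f g : regular_on_circle f -> regular_on_circle g ->
  int (fun t => f t - g t) = int f - int g.
Proof.
move=> rf rg; rewrite -[int g]mul1r -mulNr -circle_intZ// -circle_intD//.
  by apply: eq_circle_int => t _; rewrite mulN1r.
exact: regularM (regular_cst _) rg.
Qed.

Lemma circle_int_conj f : regular_on_circle f ->
  int (fun t => (f t)^*%C) = (int f)^*%C.
Proof.
move=> /regular_integrable[fr fi]; have mT := measurable_circle.
apply/eqP; rewrite eq_complex /=; apply/andP; split; apply/eqP.
  by apply: eq_Rintegral => t _; case: (f t).
rewrite -mulN1r -RintegralZl//.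
by apply: eq_Rintegral => t _; case: (f t) => ? ? /=; rewrite mulN1r.
Qed.

Lemma circle_int_sum (I : Type) (s : seq I) (F : I -> R[i] -> R[i]) :
  (forall i, regular_on_circle (F i)) ->
  int (fun t => \sum_(i <- s) F i t) = \sum_(i <- s) int (F i).
Proof.
move=> rF; elim: s => [|i s IH].
  rewrite big_nil -[RHS](mul0r (int (fun=> 0))) -circle_intZ; last exact: regular_cst.
  by apply: eq_circle_int => t _; rewrite big_nil mul0r.
rewrite big_cons -IH -circle_intD //; last exact: regular_sum.
by apply: eq_circle_int => t _; rewrite big_cons.
Qed.

(** The factor 2 comes from bounding real and imaginary parts separately. *)
Lemma circle_int_le f (M : R[i]) : regular_on_circle f ->
  (forall t, `|t| = 1 -> `|f t| <= M) -> `|int f| <= 2 * M.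
Proof.
move=> rf hM; have [fr fi] := regular_integrable rf; have mT := measurable_circle.
have M0 : 0 <= M by apply: le_trans (hM 1 (normr1 _)).
have ME : M = ((complex.Re M)%:C)%C by rewrite RRe_real ?ger0_real.
have muT : (mu T < +oo)%E by rewrite (le_lt_trans (probability_le1 mu mT)) ?ltry.
have b (h : R[i] -> R) : mu.-integrable T (EFin \o (h \o f : borelC R -> R)) ->
   (forall x, (`|h x|%:C)%C <= `|x|) ->
   (`|\int[mu]_(t in T) h (f t)|%:C)%C <= M.
  move=> hi hh; rewrite ME lecR (le_trans (le_normr_Rintegral mT hi))//.
  apply: (@le_trans _ _ (\int[mu]_(t in T) complex.Re M)).
    apply: le_Rintegral => //.
    - exact: integrable_norm.
    - apply: measurable_bounded_integrable => //.
      by exists (`|complex.Re M|); split; [exact: num_real|move=> x Mx t _; exact: ltW].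
    - move=> t t1; have := le_trans (hh (f t)) (hM t t1).
      by rewrite lecE => /andP[].
  rewrite Rintegral_cst// ler_piMr //; first by rewrite -ler0c -ME.
  by rewrite -lee_fin fineK ?probability_le1 // ge0_fin_numE.
have -> : int f = ((\int[mu]_(t in T) complex.Re (f t))%:C)%C +
   ((\int[mu]_(t in T) complex.Im (f t))%:C)%C * 'i%C.
  by apply/eqP; rewrite eq_complex /= !mul0r !mulr0 !mulr1 subr0 addr0 add0r addr0 !eqxx.
have i1 : `|'i%C : R[i]| = 1 by rewrite normc_def /= expr0n add0r expr1n sqrtr1.
rewrite (le_trans (ler_normD _ _))// normrM i1 mulr1 mulr_natl mulr2n.
have nR (x : R) : `|(x%:C)%C| = (`|x|%:C)%C.
  by rewrite normc_def /= expr0n addr0 sqrtr_sqr.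
by rewrite !nR lerD // b // => x; [exact: normc_ge_Re|exact: normc_ge_Im].
Qed.

End CircleIntegral.

(** * Domination at the points of the disc *)

Section BigO.
Variable R : realType.
Implicit Types (f g : R[i] -> R[i]) (z w c a b : R[i]).

(** f = O(g) at every point of the disc.  Punctured neighbourhoods let finitely
    many points be disregarded (the origin, for the substar conjugates).  The
    constant M is complex, but the inequality makes it a nonnegative real as soon
    as g has a nonzero value near a. *)
Definition bigO_disc f g : Prop := forall a, unit_disc a ->
  exists M : R[i], \forall z \near (a : R[i]^o)^', `|f z| <= M * `|g z|.

Lemma near_punctured a (e : R[i]) (P : R[i] -> Prop) : 0 < e ->
  (forall z, z != a -> `|z - a| < e -> P z) -> \forall z \near (a : R[i]^o)^', P z.
Proof.
move=> e0 h.
have : \forall z \near nbhs (a : R[i]^o), z != a -> P z.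
  apply: filterS (@nbhsx_ballx _ R[i]^o a e e0) => z az za.
  by apply: h => //; rewrite distrC.
by [].
Qed.

Lemma near_disc a : unit_disc a -> \forall z \near (a : R[i]^o)^', unit_disc z.
Proof.
move=> a1; apply: (@near_punctured _ (1 - `|a|)); first by rewrite subr_gt0.
move=> z _; rewrite ltrBrDl => h; apply: le_lt_trans h.
by rewrite -{1}[z](subrKC a) (le_trans (ler_normD _ _)).
Qed.

Lemma near_neq a b : \forall z \near (a : R[i]^o)^', z != b.
Proof.
have [->|ab] := eqVneq a b; first by apply: (@near_punctured _ 1).
apply: (@near_punctured _ `|b - a|); first by rewrite normr_gt0 subr_eq0 eq_sym.
by move=> z _; apply: contraTneq => ->; rewrite ltxx.
Qed.

Lemma eq_bigO f f' g : (forall z, unit_disc z -> z != 0 -> f z = f' z) ->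
  bigO_disc f g -> bigO_disc f' g.
Proof.
move=> e h a a1; have [M hM] := h a a1; exists M.
near=> z; rewrite -e; first 1 last.
- by near: z; exact: near_disc.
- by near: z; exact: near_neq.
- by near: z.
Unshelve. all: by end_near. Qed.

Lemma bigOD f1 f2 g : bigO_disc f1 g -> bigO_disc f2 g ->
  bigO_disc (fun z => f1 z + f2 z) g.
Proof.
move=> h1 h2 a a1; have [M hM] := h1 a a1; have [K hK] := h2 a a1.
exists (M + K); near=> z; rewrite (le_trans (ler_normD _ _))// mulrDl lerD//.
- by near: z.
- by near: z.
Unshelve. all: by end_near. Qed.

Lemma bigOM f1 f2 g1 g2 : bigO_disc f1 g1 -> bigO_disc f2 g2 ->
  bigO_disc (fun z => f1 z * f2 z) (fun z => g1 z * g2 z).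
Proof.
move=> h1 h2 a a1; have [M hM] := h1 a a1; have [K hK] := h2 a a1.
exists (M * K); near=> z; rewrite !normrM mulrACA ler_pM//.
- by near: z.
- by near: z.
Unshelve. all: by end_near. Qed.

Lemma bigOMl f1 f2 g : bigO_disc f1 (fun=> 1) -> bigO_disc f2 g ->
  bigO_disc (fun z => f1 z * f2 z) g.
Proof.
move=> h1 h2; have h := bigOM h1 h2 => a a1; have [M hM] := h a a1.
by exists M; apply: filterS hM => z; rewrite mul1r.
Qed.

Lemma bigO_bounded_disc f (M : R[i]) : (forall z, unit_disc z -> `|f z| <= M) ->
  bigO_disc f (fun=> 1).
Proof.
move=> h a a1; exists M; near=> z; rewrite normr1 mulr1; apply: h.
by near: z; exact: near_disc.
Unshelve. all: by end_near. Qed.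

Lemma bigO_poly (p : {poly R[i]}) : bigO_disc (fun z => p.[z]) (fun=> 1).
Proof.
apply: (@bigO_bounded_disc _ (\sum_(i < size p) `|p`_i|)) => z z1.
rewrite horner_coef (le_trans (ler_norm_sum _ _ _))// ler_sum// => i _.
by rewrite normrM normrX ler_piMr // exprn_ile1 // ltW.
Qed.

Lemma bigO_refl f : bigO_disc f f.
Proof. by move=> a _; exists 1; near=> z; rewrite mul1r.
Unshelve. all: by end_near. Qed.

Lemma bigO_continuous f :
  (forall a, unit_disc a -> {for a, continuous (f : R[i]^o -> R[i]^o)}) ->
  bigO_disc f (fun=> 1).
Proof.
move=> h a a1; exists (`|f a| + 1).
suff : \forall z \near nbhs (a : R[i]^o), z != a -> `|f z| <= (`|f a| + 1) * `|1 : R[i]|.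
  by [].
have /(@cvgrPdist_le R[i] R[i]^o _ (nbhs (a : R[i]^o)) (nbhs_filter _)) /(_ 1 ltr01) := h a a1.
apply: filterS => z hz _; rewrite normr1 mulr1.
by rewrite -{1}[f z](subrKC (f a)) (le_trans (ler_normD _ _))// lerD2l distrC.
Qed.

Lemma holomorphic_bigO f : holomorphic_on_disc f -> bigO_disc f (fun=> 1).
Proof.
move=> h; apply: bigO_continuous => a a1.
by apply: differentiable_continuous; apply/derivable1_diffP; exact: h.
Qed.

Lemma bigO_trans f g (W : R[i] -> R[i]) : bigO_disc W (fun=> 1) ->
  bigO_disc f (fun z => g z * W z) -> bigO_disc f g.
Proof.
move=> hW h a a1; have [M hM] := h a a1; have [K hK] := hW a a1.
exists (`|M| * `|K|); near=> z.
have h1 : `|f z| <= M * `|g z * W z| by near: z.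
have h2 : `|W z| <= K.
  by have : `|W z| <= K * `|1 : R[i]|; [near: z|rewrite normr1 mulr1].
have K0 : 0 <= K by apply: le_trans h2.
apply: (le_trans h1).
apply: le_trans (real_ler_norm (ger0_real (le_trans (normr_ge0 _) h1))) _.
rewrite !normrM !normr_id -mulrA ler_wpM2l// [leRHS]mulrC ler_wpM2l//.
by rewrite (ger0_norm K0).
Unshelve. all: by end_near. Qed.

(** The bound forces p to vanish at the first zero b of the product, and after
    division by X - b it becomes the same bound for the remaining zeros, because
    z <> b near any point.  Multiplicities are thus treated with no reference to
    holomorphy. *)
Lemma bigO_dvd (s : seq R[i]) (p : {poly R[i]}) : (forall b, b \in s -> unit_disc b) ->
  bigO_disc (horner p) (horner (\prod_(b <- s) ('X - b%:P))) ->
  \prod_(b <- s) ('X - b%:P) %| p.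
Proof.
elim: s p => [|b s IH] p sD h; first by rewrite big_nil dvd1p.
set Z := \prod_(b <- s) ('X - b%:P) in IH *.
have bD : unit_disc b by apply: sD; rewrite mem_head.
rewrite big_cons -/Z in h *.
have pb0 : root p b.
  apply/negPn/negP; rewrite /root => pb0.
  have [M hM] := h b bD; have [K hK] := bigO_poly Z bD.
  have [q pE] : exists q, p - p.[b]%:P = q * ('X - b%:P).
    by apply/factor_theorem; rewrite /root !hornerE subrr.
  have [L hL] := bigO_poly q bD.
  pose e := `|p.[b]| / (`|M| * `|K| + `|L| + 1).
  have e0 : 0 < e by rewrite divr_gt0 ?normr_gt0// ltr_wpDl// addr_ge0// mulr_ge0.
  suff [z [] ] : exists z, ~ (z != b /\ `|z - b| < e) /\ (z != b /\ `|z - b| < e) by [].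
  apply: (@filter_ex _ (b : R[i]^o)^'); near=> z; split; last first.
    split; first by near: z; exact: near_neq.
    by near: z; exact: (near_punctured e0).
  have z1 : `|p.[z]| <= M * `|(('X - b%:P) * Z).[z]| by near: z.
  have z2 : `|Z.[z]| <= K * `|1 : R[i]| by near: z.
  have z3 : `|q.[z]| <= L * `|1 : R[i]| by near: z.
  case=> zb; rewrite /e ltr_pdivlMr; last by rewrite ltr_wpDl// addr_ge0// mulr_ge0.
  apply/negP; suff : `|p.[b]| <= `|z - b| * (`|M| * `|K| + `|L| + 1).
    by move=> le1; apply/negP => lt1; have := le_lt_trans le1 lt1; rewrite ltxx.
  have -> : p.[b] = p.[z] - q.[z] * (z - b).
    by have /(congr1 (horner^~ z)) := pE; rewrite !hornerE => <-; ring.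
  rewrite normr1 !mulr1 in z2 z3.
  have K0 : 0 <= K by apply: le_trans z2. have L0 : 0 <= L by apply: le_trans z3.
  rewrite (le_trans (ler_normB _ _))// [leRHS]mulrDr mulr1 -[leLHS]addr0 lerD//.
  rewrite [leRHS]mulrDr.
  apply: lerD; last by rewrite normrM mulrC ler_wpM2l// (ger0_norm L0).
  apply: (le_trans z1).
  apply: le_trans (real_ler_norm (ger0_real (le_trans (normr_ge0 _) z1))) _.
  rewrite hornerM hornerXsubC !normrM !normr_id mulrCA.
  by rewrite ler_wpM2l// ler_wpM2l// (ger0_norm K0).
have [q pE] := factor_theorem _ _ pb0; rewrite pE mulrC dvdp_mul2r ?polyXsubC_eq0//.
apply: IH => [c cs|a a1]; first by apply: sD; rewrite inE cs orbT.
have [M hM] := h a a1; exists M; near=> z.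
have z1 : `|p.[z]| <= M * `|(('X - b%:P) * Z).[z]| by near: z.
have zb : 0 < `|z - b| by rewrite normr_gt0 subr_eq0; near: z; exact: near_neq.
rewrite -(ler_pM2r zb) -normrM; move: z1; rewrite pE !hornerM hornerXsubC (normrM q.[z]).
by move=> /le_trans; apply; rewrite normrM [leLHS]mulrCA [leLHS]mulrC.
Unshelve. all: by end_near. Qed.

End BigO.

(** * The Cauchy kernel and its transforms *)

Section SecondKind.
Variables (R : realType) (mu : probability (borelC R) R) (b0 : R[i]).
Hypothesis b0D : unit_disc b0.
Implicit Types (t z w c b : R[i]) (h g : R[i] -> R[i]) (p q : {poly R[i]}).
Local Notation int := (circle_int mu).

Lemma one_sub_conj_neq0 b z : `|b| < 1 -> `|z| <= 1 -> 1 - (b^*)%C * z != 0.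
Proof.
move=> b1 z1; rewrite subr_eq0; apply: contraTneq b1 => e.
have : `|(b^*)%C * z| = 1 by rewrite -e normr1.
rewrite normrM normcJ => e1; apply/negP => b1.
have : `|b| * `|z| <= `|b| by rewrite ler_piMr.
by rewrite e1 => /le_lt_trans /(_ b1); rewrite ltxx.
Qed.

Definition kappa : R[i] := 1 - (b0^*)%C * b0.

Lemma kappa_neq0 : kappa != 0.
Proof. by apply: one_sub_conj_neq0 => //; exact: ltW. Qed.

Lemma kappa_conj : (kappa^*)%C = kappa.
Proof. by rewrite /kappa rmorphB rmorphM rmorph1 /= conjcK mulrC. Qed.

Lemma eta_neq0 b : Defs.eta b != 0.
Proof.
rewrite /Defs.eta. case: (eqVneq b 0) => [_|b_neq0]; first exact: oner_neq0.
by rewrite mulf_neq0 ?invr_eq0 ?normr_eq0 ?conjc_eq0.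
Qed.

Lemma horner_varpi b z : (1 - (b^*)%C *: 'X).[z] = 1 - (b^*)%C * z.
Proof. by rewrite !hornerE. Qed.

Lemma ratval_zeta b z : 1 - (b^*)%C * z != 0 ->
  ratval (zeta b) z = Defs.eta b * (z - b) / (1 - (b^*)%C * z).
Proof.
move=> h; rewrite /zeta /ratconst /varpis /varpi -tofracM ratval_fraction horner_varpi //.
by rewrite hornerM hornerC hornerXsubC.
Qed.

(** D_0(t,z) + 1 = 2 zeta_0(t) / (zeta_0(t) - zeta_0(z)), written so that it also
    makes sense for |z| > 1. *)
Definition cauchy_kernel t z : R[i] :=
  2 * (t - b0) * (1 - (b0^*)%C * z) / (kappa * (t - z)).

Lemma D0_cauchy_kernel t z : `|t| = 1 -> unit_disc z -> D0 b0 t z = cauchy_kernel t z - 1.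
Proof.
move=> t1 zD; have tz : t - z != 0.
  by rewrite subr_eq0; apply: contraTneq zD => <-; rewrite /unit_disc /= t1 ltxx.
have t1_le : `|t| <= 1 by rewrite t1.
have ht := one_sub_conj_neq0 b0D t1_le.
have hz := one_sub_conj_neq0 b0D (ltW zD).
rewrite /D0 !ratval_zeta //; have e0 := eta_neq0 b0.
have k0 := kappa_neq0; move: k0; rewrite /cauchy_kernel /kappa => k0.
have -> : Defs.eta b0 * (t - b0) / (1 - (b0^*)%C * t) -
    Defs.eta b0 * (z - b0) / (1 - (b0^*)%C * z) =
    Defs.eta b0 * (1 - (b0^*)%C * b0) * (t - z) /
    ((1 - (b0^*)%C * t) * (1 - (b0^*)%C * z)).
  by field; rewrite ht hz.
by field; rewrite ht hz e0 k0 tz.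
Qed.

Lemma conj_unit t : `|t| = 1 -> (t^*)%C = t^-1.
Proof. by move=> t1; rewrite invc_norm t1 expr1n invr1 mul1r. Qed.

Lemma conjcM z w : ((z * w)^*)%C = (z^*)%C * (w^*)%C.
Proof. exact: rmorphM. Qed.

Lemma conjcB z w : ((z - w)^*)%C = (z^*)%C - (w^*)%C.
Proof. exact: rmorphB. Qed.

(** In other words conj D_0(t, 1 / conj z) = - D_0(t, z), since conj t = 1 / t. *)
Lemma cauchy_kernel_conj t z : `|t| = 1 -> unit_disc z -> z != 0 ->
  ((cauchy_kernel t (z^*)%C^-1)^*)%C = 2 - cauchy_kernel t z.
Proof.
move=> t1 zD z0; have tz : t - z != 0.
  by rewrite subr_eq0; apply: contraTneq zD => <-; rewrite /unit_disc /= t1 ltxx.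
have t0 : t != 0 by rewrite -normr_eq0 t1 oner_neq0.
rewrite /cauchy_kernel; have := kappa_neq0; have := kappa_conj.
have : kappa = 1 - (b0^*)%C * b0 by [].
move: kappa => k kE kc k0.
rewrite conjcM conjc_inv !conjcM !conjcB !conjcM conjc_inv !conjcK.
rewrite kc (conj_unit t1) conjc1 conjc_nat.
have -> : t^-1 - z^-1 = - (t - z) / (t * z) by field; rewrite t0 z0.
rewrite kE in k0 *; field.
by rewrite t0 z0 tz k0.
Qed.

Lemma regular_cauchy_kernel w : `|w| != 1 ->
  regular_on_circle (fun t => cauchy_kernel t w).
Proof.
move=> w1; apply: (eq_regular _ (regularM (regular_poly
   ((2 * (1 - (b0^*)%C * w) / kappa) *: ('X - b0%:P))) (regular_inv_sub w1))) => t _.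
rewrite hornerZ hornerXsubC /cauchy_kernel invfM !mulrA.
by congr (_ / _); rewrite mulrAC (mulrAC 2).
Qed.

(** For t on the circle, q h(t) - p vanishes at t, so its product with the kernel
    is a polynomial in w and the integrand is a polynomial in w of degree at
    most m.  Lagrange interpolation at m + 1 points off the circle writes it as a
    combination of its values there, and integrating the values gives the
    numerator. *)
Lemma second_kind_numerator m p q h : (size p <= m.+1)%N -> (size q <= m.+1)%N ->
  regular_on_circle h -> (forall t, `|t| = 1 -> h t * q.[t] = p.[t]) ->
  exists2 s : {poly R[i]}, (size s <= m.+1)%N & forall w, `|w| != 1 ->
    s.[w] = q.[w] * int (fun t => h t * cauchy_kernel t w)
            - p.[w] * int (fun t => cauchy_kernel t w - 1).
Proof.
move=> sp sq rh hE.
pose G t w := q.[w] * (h t * cauchy_kernel t w) - p.[w] * (cauchy_kernel t w - 1).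
pose u t := (h t *: q - p) %/ ('X - t%:P).
pose f t := ((- 2 * (t - b0) / kappa) *: ((1 - (b0^*)%C *: 'X) * u t) + p).
have szf t : (size (f t) <= m.+1)%N.
  rewrite (leq_trans (size_polyD _ _))// geq_max sp andbT.
  rewrite (leq_trans (size_scale_leq _ _))// (leq_trans (size_polyMleq _ _))//.
  have su : (size (u t) <= m)%N.
    rewrite size_divp ?polyXsubC_eq0// size_XsubC leq_subLR add1n.
    rewrite (leq_trans (size_polyD _ _))// geq_max size_polyN sp andbT.
    by rewrite (leq_trans (size_scale_leq _ _)).
  have s2 : (size (1 - (b0^*)%C *: 'X : {poly R[i]})%R <= 2)%N.
    rewrite (leq_trans (size_polyD _ _))// geq_max size_polyN size_polyC.
    rewrite (leq_trans (leq_b1 _))//= (leq_trans (size_scale_leq _ _))//.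
    by rewrite size_polyX.
  by rewrite -subn1 leq_subLR add1n (leq_trans (leq_add s2 su)).
have fE t w : `|t| = 1 -> `|w| != 1 -> (f t).[w] = G t w.
  move=> t1 w1; have tw : t - w != 0.
    by rewrite subr_eq0; apply: contraNneq w1 => <-; rewrite t1.
  have /(congr1 (horner^~ w)) : u t * ('X - t%:P) = h t *: q - p.
    by rewrite divpK // dvdp_XsubCl /root !hornerE hE // subrr.
  rewrite /f /G !(hornerD, hornerZ, hornerM, hornerN, hornerC, hornerX) => uE.
  have -> : (u t).[w] = - (h t * q.[w] - p.[w]) / (t - w).
    by rewrite -uE -mulrN opprB mulfK.
  rewrite /cauchy_kernel; have := kappa_neq0; move: kappa => k k0.
  by field; rewrite k0 tw.
have rG w : `|w| != 1 -> regular_on_circle (G ^~ w).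
  move=> w1; have rk := regular_cauchy_kernel w1.
  apply: (regularD (regularM (regular_cst q.[w]) (regularM rh rk))).
  have rk1 := regularD rk (regular_cst (-1)).
  apply: (eq_regular _ (regularM (regular_cst (- p.[w])) rk1)).
  by move=> t _; rewrite mulNr.
pose x (j : nat) : R[i] := (j.+2%:R)^-1.
have x1 j : `|x j| != 1.
  by rewrite normfV normr_nat invr_eq1 -[1]/(1%:R) eqr_nat.
have x_inj : injective x.
  by move=> i j /invr_inj/eqP; rewrite eqr_nat => /eqP[].
pose l j : {poly R[i]} := tnth (lagrange m.+1 x) j.
exists (\sum_(j < m.+1) int (G ^~ (x j)) *: l j).
  rewrite (leq_trans (size_sum _ _ _))//; apply/bigmax_leqP => j _.
  by rewrite (leq_trans (size_scale_leq _ _))// size_lagrange_.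
move=> w w1; rewrite horner_sum.
transitivity (int (G ^~ w)); last first.
  have rk := regular_cauchy_kernel w1; have rk1 := regularD rk (regular_cst (-1)).
  have rhk := regularM rh rk.
  rewrite -(circle_intZ _ _ rhk) -(circle_intZ _ _ rk1) circle_intB //.
    exact: regularM (regular_cst _) rhk.
  exact: regularM (regular_cst _) rk1.
transitivity (int (fun t => \sum_(j < m.+1) (l j).[w] * G t (x j))); last first.
  apply: eq_circle_int => t t1; rewrite -fE//.
  rewrite [in RHS](lagrange_gen (ltn0Sn m) x_inj (szf t)) horner_sum.
  by apply: eq_bigr => j _; rewrite hornerM hornerC fE// mulrC.
rewrite circle_int_sum => [|j]; last exact: regularM (regular_cst _) (rG _ (x1 j)).
by apply: eq_bigr => j _; rewrite circle_intZ ?hornerZ 1?mulrC//; exact: rG.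
Qed.

(** Near a, the denominator t - z stays away from 0 by half the distance from a
    to the circle. *)
Lemma cauchy_transform_bigO h : regular_on_circle h ->
  bigO_disc (fun z => int (fun t => h t / (t - z))) (fun=> 1).
Proof.
move=> rh a a1; have [_ _ [M hM]] := rh.
have M0 : 0 <= M by apply: le_trans (hM 1 (normr1 _)).
pose d := (1 - `|a|) / 2; have d0 : 0 < d by rewrite divr_gt0// subr_gt0.
exists (2 * (M / d)); apply: (near_punctured d0) => z _ za.
have tz t : `|t| = 1 -> d <= `|t - z|.
  move=> t1; rewrite -(lerD2r `|z - a|).
  apply: (@le_trans _ _ (d + d)); first by rewrite lerD2l ltW.
  have -> : d + d = 1 - `|a| by rewrite [RHS]splitr.
  rewrite lerBlDr -addrA -t1 -{1}(subrK z t) (le_trans (ler_normD _ _))// lerD2l.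
  by rewrite -{1}(subrK a z) (le_trans (ler_normD _ _)).
have z1 : `|z| != 1.
  by apply/eqP => z1; have := lt_le_trans d0 (tz z z1); rewrite subrr normr0 ltxx.
rewrite normr1 mulr1; apply: circle_int_le.
  exact: regularM rh (regular_inv_sub z1).
move=> t t1; rewrite normrM normfV ler_pM ?invr_ge0//; first exact: hM.
by rewrite lef_pV2 ?posrE ?tz// (lt_le_trans d0)// tz.
Qed.

(** Write Z(t) - Z(z) = U(t) (t - z), Z being the product on the right of the
    bound.  Then (t - b0) / (t - z) is the sum of (t - b0) U(t) / Z(t), whose
    integral against h vanishes by orthogonality, and of
    Z(z) (t - b0) / (Z(t) (t - z)), whose integral against h is Z(z) times a
    Cauchy transform. *)
Lemma orthogonal_transform_bigO (s : seq R[i]) h :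
  (forall b, b \in s -> unit_disc b) -> regular_on_circle h ->
  (forall U : {poly R[i]}, (size U <= (size s).+1)%N ->
     int (fun t => h t * (U.[t] / (\prod_(b <- s) ('X - b%:P)).[t])) = 0) ->
  bigO_disc (fun z => int (fun t => h t * cauchy_kernel t z))
    (horner (\prod_(b <- b0 :: s) ('X - b%:P))).
Proof.
move=> sD rh orth; rewrite big_cons; set Z1 := \prod_(b <- s) _.
set Z := _ * Z1.
have Z1t t : `|t| = 1 -> Z1.[t] != 0.
  move=> t1; rewrite horner_prod prodf_seq_neq0; apply/allP => b bs /=.
  rewrite hornerXsubC subr_eq0; apply: contraTneq (sD b bs) => <-.
  by rewrite /unit_disc /= t1 ltxx.
have rZ1 : regular_on_circle (fun t => Z1.[t]^-1).
  rewrite /Z1; elim: (s) sD => [|b s' IH] sD.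
    by apply: (eq_regular _ (regular_cst 1)) => t _; rewrite big_nil hornerC invr1.
  have bD : `|b| != 1 by rewrite lt_eqF //; apply: sD; rewrite mem_head.
  have /IH rs : forall c, c \in s' -> unit_disc c.
    by move=> c cs; apply: sD; rewrite inE cs orbT.
  apply: (eq_regular _ (regularM (regular_inv_sub bD) rs)) => t _.
  by rewrite big_cons hornerM hornerXsubC invfM.
have rhZ := regularM rh rZ1.
have h1 := bigOM (bigO_refl (horner Z)) (cauchy_transform_bigO rhZ).
have h2 := bigOMl (bigO_poly ((2 / kappa) *: (1 - (b0^*)%C *: 'X))) h1.
have h3 : bigO_disc (fun z => ((2 / kappa) *: (1 - (b0^*)%C *: 'X)).[z] *
   (Z.[z] * int (fun t => h t * Z1.[t]^-1 / (t - z)))) (horner Z).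
  move=> a a1; have [M hM] := h2 a a1; exists M; apply: filterS hM => z.
  by rewrite mulr1.
apply: eq_bigO h3 => z zD _.
have z1 : `|z| != 1 by rewrite lt_eqF.
pose U := (Z - Z.[z]%:P) %/ ('X - z%:P).
have UE : U * ('X - z%:P) = Z - Z.[z]%:P.
  by rewrite divpK // dvdp_XsubCl /root !(hornerD, hornerN, hornerC) subrr.
have sZ : size Z = (size s).+2.
  by rewrite -[RHS](size_prod_XsubC (b0 :: s) id) big_cons.
have sU : (size U <= (size s).+1)%N.
  rewrite size_divp ?polyXsubC_eq0// size_XsubC leq_subLR add1n.
  rewrite (leq_trans (size_polyD _ _))// geq_max size_polyN size_polyC.
  by rewrite (leq_trans (leq_b1 _))// andbT sZ.
have rI := regularM rhZ (regular_inv_sub z1).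
have rU : regular_on_circle (fun t => h t * (U.[t] / Z1.[t])).
  exact: regularM rh (regularM (regular_poly U) rZ1).
rewrite hornerZ horner_varpi -(circle_intZ _ _ rI).
set A := 2 / kappa * _.
rewrite -[X in A * X]add0r -(orth U sU) -circle_intD //; last first.
  exact: regularM (regular_cst _) rI.
rewrite -circle_intZ; last first.
  exact: regularD rU (regularM (regular_cst _) rI).
apply: eq_circle_int => t t1.
have tz : t - z != 0 by rewrite subr_eq0; apply: contraNneq z1 => <-; rewrite t1.
have := congr1 (horner^~ t) UE.
rewrite /Z !(hornerM, hornerD, hornerN, hornerC, hornerX) => Ut.
have -> : U.[t] = ((t - b0) * Z1.[t] - (z - b0) * Z1.[z]) / (t - z).
  by rewrite -Ut mulfK.
have k0 := kappa_neq0; rewrite /cauchy_kernel /A; move: kappa k0 => k k0.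
by field; rewrite Z1t // k0 tz.
Qed.

(** The kernel at 1 / conj z conjugates to the negative of D_0 - 1, which carries
    the factor z - b0; no orthogonality is involved. *)
Lemma reflected_transform_bigO h : regular_on_circle h ->
  bigO_disc (fun z => ((int (fun t => h t * cauchy_kernel t (z^*)%C^-1))^*)%C)
    (horner ('X - b0%:P)).
Proof.
move=> rh.
have rg : regular_on_circle
    (fun t => (h t)^*%C * (- 2 / kappa * (1 - (b0^*)%C *: 'X).[t])).
  exact: regularM (regular_conj rh) (regularM (regular_cst _) (regular_poly _)).
have h1 := bigOMl (cauchy_transform_bigO rg) (bigO_refl (horner ('X - b0%:P))).
apply: eq_bigO h1 => z zD z0.
have z1 : `|z| != 1 by rewrite lt_eqF.
have w1 : `|(z^*)%C^-1| != 1 by rewrite normfV normcJ invr_eq1.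
rewrite -circle_int_conj; last exact: regularM rh (regular_cauchy_kernel w1).
rewrite mulrC -circle_intZ; last exact: regularM rg (regular_inv_sub z1).
apply: eq_circle_int => t t1.
have tz : t - z != 0 by rewrite subr_eq0; apply: contraNneq z1 => <-; rewrite t1.
rewrite conjcM cauchy_kernel_conj// horner_varpi hornerXsubC /cauchy_kernel.
have k0 := kappa_neq0; have : kappa = 1 - (b0^*)%C * b0 by [].
move: kappa k0 => k k0 kE; rewrite kE in k0 *; field.
by rewrite k0 tz.
Qed.

End SecondKind.

(** * Numerators, denominators and Blaschke products *)

Section ZerosPoles.
Variable R : realType.
Implicit Types (s : seq R[i]) (p q u v : {poly R[i]}) (f g : ratfun R) (b : R[i]).

(** The polynomials whose roots are the points b, resp. the reflected points
    1 / conj b (a point b = 0 only lowers the degree of [poles]). *)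
Definition zeros s : {poly R[i]} := \prod_(b <- s) ('X - b%:P).
Definition poles s : {poly R[i]} := \prod_(b <- s) (1 - (b^*)%C *: 'X).

Lemma size_pole b : (size (1 - (b^*)%C *: 'X : {poly R[i]})%R <= 2)%N.
Proof.
rewrite (leq_trans (size_polyD _ _))// geq_max size_polyN size_polyC.
by rewrite (leq_trans (leq_b1 _))//= (leq_trans (size_scale_leq _ _))// size_polyX.
Qed.

Lemma size_poles s : (size (poles s) <= (size s).+1)%N.
Proof.
elim: s => [|b s IH]; first by rewrite /poles big_nil size_polyC leq_b1.
rewrite /poles big_cons (leq_trans (size_polyMleq _ _))// -subn1 leq_subLR add1n.
exact: (leq_trans (leq_add (size_pole b) IH)).
Qed.

Lemma size_zeros s : size (zeros s) = (size s).+1.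
Proof. exact: size_prod_XsubC. Qed.

Lemma zeros_neq0 s : zeros s != 0.
Proof. by rewrite -size_poly_eq0 size_zeros. Qed.

Lemma zeros_monic s : zeros s \is monic.
Proof. exact: monic_prod_XsubC. Qed.

Lemma poles_cat s1 s2 : poles (s1 ++ s2) = poles s1 * poles s2.
Proof. exact: big_cat. Qed.
Lemma zeros_cat s1 s2 : zeros (s1 ++ s2) = zeros s1 * zeros s2.
Proof. exact: big_cat. Qed.

Lemma reversal_poles s : reversal (size s) (poles s) = zeros s.
Proof.
elim: s => [|b s IH].
  apply/polyP => i; rewrite /poles /zeros !big_nil coef_poly /=.
  by case: i => [|i] /=; rewrite !coef1 ?conjc1.
rewrite /poles /zeros !big_cons -/(poles s) -/(zeros s) -IH.
rewrite -[size _]add1n (reversalM (size_pole b) (size_poles s)); congr (_ * _).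
apply/polyP => i; rewrite coef_poly !coefD !coefN coefZ !coefX !coefC.
case: i => [|[|i]] //=; rewrite ?(mulr1, mulr0, subr0, sub0r, conjc1, addr0) //.
by rewrite rmorphN /= conjcK.
Qed.

Lemma reversal_zeros s : reversal (size s) (zeros s) = poles s.
Proof. by rewrite -reversal_poles reversalK ?size_poles. Qed.

Lemma poles_root_disc s z : (forall b, b \in s -> unit_disc b) -> `|z| <= 1 ->
  (poles s).[z] != 0.
Proof.
move=> sD z1; rewrite horner_prod prodf_seq_neq0; apply/allP => b bs /=.
by rewrite horner_varpi one_sub_conj_neq0//; exact: sD.
Qed.

Lemma poles_neq0 s : (forall b, b \in s -> unit_disc b) -> poles s != 0.
Proof.
move=> sD; apply: contraTneq (poles_root_disc sD (z := 0) _) => [->|].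
  by rewrite horner0 eqxx.
by rewrite normr0 ler01.
Qed.

Lemma zeros_coprime s p : (forall b, b \in s -> ~~ root p b) -> coprimep (zeros s) p.
Proof.
elim: s => [|b s IH] h; first by rewrite /zeros big_nil coprime1p.
rewrite /zeros big_cons coprimepMl [coprimep ('X - _) _]coprimep_sym.
rewrite coprimep_XsubC h ?mem_head//=.
by apply: IH => c cs; apply: h; rewrite inE cs orbT.
Qed.

Lemma zeros_poles_coprime s t : (forall b, b \in s -> unit_disc b) ->
  (forall b, b \in t -> unit_disc b) -> coprimep (zeros s) (poles t).
Proof.
move=> sD tD; apply: zeros_coprime => b bs; apply: poles_root_disc => //.
by apply: ltW; exact: sD.
Qed.

Lemma size_cofactor s M u v : (size u <= (size s + M).+1)%N -> u = zeros s * v ->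
  (size v <= M.+1)%N.
Proof.
have [->|v0] := eqVneq v 0; first by rewrite size_poly0.
move=> su uE; move: su; rewrite uE size_monicM ?zeros_monic// size_zeros addSn /=.
by rewrite -addnS leq_add2l.
Qed.

(** Reversal exchanges [zeros] and [poles], so divisibility of the reversal by
    [zeros s] makes u a multiple of [poles s], with a cofactor of the right size
    even when some points are 0.  The two products are coprime, their roots lying
    inside, resp. outside, the circle. *)
Lemma zeros_poles_factor s M u : (forall b, b \in s -> unit_disc b) ->
  (size u <= (size s + (size s + M)).+1)%N ->
  zeros s %| u -> zeros s %| reversal (size s + (size s + M)) u ->
  exists2 v : {poly R[i]}, (size v <= M.+1)%N & u = zeros s * poles s * v.
Proof.
move=> sD su Zu /dvdpP[y yE]; rewrite mulrC in yE.
have sy := size_cofactor (size_reversal _ u) yE.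
have uE : u = poles s * reversal (size s + M) y.
  rewrite -[LHS](reversalK su) yE reversalM ?size_zeros// reversal_zeros //.
move: Zu; rewrite {1}uE Gauss_dvdpr ?zeros_poles_coprime// => /dvdpP[v vE].
rewrite mulrC in vE; exists v; last by rewrite uE vE mulrCA mulrA.
exact: size_cofactor (size_reversal _ y) vE.
Qed.

Lemma varpi_poles s : \prod_(b <- s) varpi b = toratfun (poles s).
Proof. by rewrite [RHS]rmorph_prod. Qed.

Lemma ratspaceP s f : ratspace s f <->
  exists2 p : {poly R[i]}, (size p <= (size s).+1)%N &
    f = toratfun p / toratfun (poles s).
Proof. by rewrite /ratspace /= varpi_poles. Qed.

Lemma substar_ratspace s p : (size p <= (size s).+1)%N -> poles s != 0 ->
  substar (toratfun p / toratfun (poles s)) =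
  toratfun (reversal (size s) p) / toratfun (zeros s).
Proof.
move=> sp p0; rewrite substar_fraction// (polystar_reversal sp).
rewrite (polystar_reversal (size_poles s)) reversal_poles.
by rewrite invf_div mulrA divfK// tofrac_eq0 expf_neq0// polyX_eq0.
Qed.

Lemma zeta_prod s : (forall b, b \in s -> unit_disc b) ->
  \prod_(b <- s) zeta b =
  ratconst (\prod_(b <- s) Defs.eta b) * (toratfun (zeros s) / toratfun (poles s)).
Proof.
elim: s => [|b s IH] sD.
  by rewrite /zeros /poles !big_nil ratconst1 !tofrac1 divr1 mulr1.
have h := poles_neq0 sD.
rewrite /poles big_cons -tofrac_eq0 tofracM mulf_eq0 negb_or in h.
case/andP: h => h1 h2.
rewrite /zeros /poles !big_cons IH; last by move=> c cs; apply: sD; rewrite inE cs orbT.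
rewrite ratconstM !tofracM /zeta /varpi /varpis /zeros /poles.
move: (toratfun (1 - _)) h1 (toratfun (\prod_(_ <- _) (1 - _))) h2 => x h1 y h2.
by rewrite invfM; ring.
Qed.

Lemma eta_prod_neq0 s : \prod_(b <- s) Defs.eta b != 0.
Proof. by rewrite prodf_seq_neq0; apply/allP => b _ /=; exact: eta_neq0. Qed.

Lemma blaschke_prod (beta : nat -> R[i]) (k : nat) :
  blaschke beta k = \prod_(b <- points beta k) zeta b.
Proof. by rewrite /blaschke /points big_map /index_iota subn1. Qed.

Lemma varpi_neq0 b : unit_disc b -> varpi b != 0.
Proof.
move=> bD; rewrite tofrac_eq0; apply: contraTneq (@one_sub_conj_neq0 R b 0 bD _) => [e|].
  by rewrite -horner_varpi e horner0 eqxx.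
by rewrite normr0 ler01.
Qed.

Lemma varpis_neq0 b : varpis b != 0.
Proof. by rewrite tofrac_eq0 polyXsubC_eq0. Qed.

Lemma zeta_neq0 b : unit_disc b -> zeta b != 0.
Proof.
move=> bD; rewrite /zeta !mulf_neq0 ?invr_eq0 ?varpi_neq0 ?varpis_neq0//.
by rewrite ratconst_neq0 ?eta_neq0.
Qed.

Lemma substar_varpi b : substar (varpi b) = varpis b / toratfun 'X.
Proof.
rewrite substar_poly polystarD polystarN polystarC -mul_polyC polystarM polystarC.
rewrite polystarX conjc1 ratconst1 conjcK /varpis tofracB.
have X0 : toratfun ('X : {poly R[i]}) != 0 by rewrite tofrac_eq0 polyX_eq0.
by rewrite mulrBl divff.
Qed.

Lemma substar_varpis b : substar (varpis b) = varpi b / toratfun 'X.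
Proof.
rewrite substar_poly polystarD polystarN polystarC polystarX /varpi tofracB tofrac1.
have X0 : toratfun ('X : {poly R[i]}) != 0 by rewrite tofrac_eq0 polyX_eq0.
by rewrite mulrBl mul1r -mul_polyC tofracM mulfK.
Qed.

Lemma conj_eta b : ((Defs.eta b)^*)%C = (Defs.eta b)^-1.
Proof.
apply: conj_unit; rewrite /Defs.eta; case: (eqVneq b 0) => [_|b0]; first exact: normr1.
by rewrite normrM normfV normcJ normr_id divff ?normr_eq0.
Qed.

Lemma substar_zeta b : unit_disc b -> substar (zeta b) = (zeta b)^-1.
Proof.
move=> bD; rewrite /zeta !substarM substarV substar_ratconst substar_varpi substar_varpis.
have X0 : toratfun ('X : {poly R[i]}) != 0 by rewrite tofrac_eq0 polyX_eq0.
have h1 := varpi_neq0 bD; have h2 := varpis_neq0 b.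
have h3 := ratconst_neq0 (eta_neq0 b).
have aux (K : fieldType) (X v w e : K) : X != 0 -> v != 0 -> w != 0 -> e != 0 ->
    e^-1 * (v / X) / (w / X) = (e * w / v)^-1.
  by move=> hX hv hw he; field; rewrite hX hv hw he.
rewrite conj_eta ratconstV.
exact: (aux _ _ _ _ _ X0 h1 h2 h3).
Qed.

Lemma prod_zeta_neq0 s : (forall b, b \in s -> unit_disc b) ->
  \prod_(b <- s) zeta b != 0.
Proof.
by move=> sD; rewrite prodf_seq_neq0; apply/allP => b /sD /zeta_neq0.
Qed.

Lemma substar_prod_zeta s : (forall b, b \in s -> unit_disc b) ->
  substar (\prod_(b <- s) zeta b) = (\prod_(b <- s) zeta b)^-1.
Proof.
elim: s => [|b s IH] sD.
  by rewrite big_nil invr1 -tofrac1 substar_poly polystarC conjc1 ratconst1 tofrac1.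
rewrite !big_cons substarM invfM substar_zeta ?IH//; last by apply: sD; rewrite mem_head.
by move=> c cs; apply: sD; rewrite inE cs orbT.
Qed.

Lemma ratval_varpi b : ratval (varpi b) b = 1 - (b^*)%C * b.
Proof.
rewrite /varpi -[toratfun _]divr1 -tofrac1 ratval_fraction ?hornerC ?oner_eq0//.
by rewrite horner_varpi divr1.
Qed.

Lemma ratval_varpi_real b : ((ratval (varpi b) b)^*)%C = ratval (varpi b) b.
Proof. by rewrite ratval_varpi; exact: kappa_conj. Qed.

Lemma ratval_varpi_neq0 b : unit_disc b -> ratval (varpi b) b != 0.
Proof. by move=> bD; rewrite ratval_varpi; exact: kappa_neq0. Qed.

Lemma PN_neq0 (beta : nat -> R[i]) N : unit_disc (beta 0%N) -> unit_disc (beta N) ->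
  PN beta N != 0.
Proof.
move=> b0 bN; rewrite /PN !mulf_neq0 ?invr_eq0 ?mulf_neq0 ?varpi_neq0 ?varpis_neq0//.
  by rewrite ratconst_neq0 ?ratval_varpi_neq0.
by rewrite ratconst_neq0 ?ratval_varpi_neq0.
Qed.

Lemma substar_PN (beta : nat -> R[i]) N : unit_disc (beta 0%N) -> unit_disc (beta N) ->
  substar (PN beta N) = PN beta N.
Proof.
move=> b0 bN; rewrite /PN !(substarM, substarV) !substar_ratconst !ratval_varpi_real.
rewrite !substar_varpi !substar_varpis.
have X0 : toratfun ('X : {poly R[i]}) != 0 by rewrite tofrac_eq0 polyX_eq0.
have h3 := ratconst_neq0 (ratval_varpi_neq0 b0).
have h1 := varpi_neq0 bN; have h2 := varpis_neq0 (beta N).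
have aux (K : fieldType) (X v w x y c d : K) : X != 0 -> v != 0 -> w != 0 -> d != 0 ->
    c * (y / X) * (x / X) / (d * (w / X) * (v / X)) = c * x * y / (d * v * w).
  by move=> hX hv hw hd; field; rewrite hX hv hw hd.
exact: (aux _ _ _ _ _ _ _ _ X0 h1 h2 h3).
Qed.

End ZerosPoles.

(** * Interpolation by an orthogonal function and its second kind function *)

Section Interpolation.
Variable R : realType.
Implicit Types (s : seq R[i]) (p q u v : {poly R[i]}) (f g : ratfun R) (b : R[i]).

Lemma regular_inv_poles s : (forall b, b \in s -> unit_disc b) ->
  regular_on_circle (fun t => (poles s).[t]^-1).
Proof.
elim: s => [|b s IH] sD.
  by apply: (eq_regular _ (regular_cst 1)) => t _; rewrite /poles big_nil hornerC invr1.
have bD : unit_disc b by apply: sD; rewrite mem_head.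
have /IH rs : forall c, c \in s -> unit_disc c.
  by move=> c cs; apply: sD; rewrite inE cs orbT.
have rb : regular_on_circle (fun t => (1 - (b^*)%C * t)^-1).
  apply: (@regularV _ _ (1 - `|b|)); first by rewrite subr_gt0.
    move=> t t1; have e : `|(b^*)%C * t| = `|b| by rewrite normrM normcJ t1 mulr1.
    by rewrite -e -{1}(normr1 R[i]) lerB_dist.
  apply: (eq_regular _ (regular_poly (1 - (b^*)%C *: 'X))) => t _.
  by rewrite horner_varpi.
apply: (eq_regular _ (regularM rb rs)) => t _.
by rewrite /poles big_cons hornerM horner_varpi invfM.
Qed.

Lemma poly_zero_on_disc p : (forall z, unit_disc z -> p.[z] = 0) -> p = 0.
Proof.
move=> h; pose x (j : nat) : R[i] := (j.+2%:R)^-1.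
apply: (@roots_geq_poly_eq0 _ _ [seq x j | j <- iota 0 (size p)]).
- apply/allP => _ /mapP[j _ ->]; apply/rootP/h.
  rewrite /unit_disc /= normfV normr_nat invf_lt1 ?ltr0n//.
  by rewrite -[1]/(1%:R) ltr_nat.
- rewrite map_inj_uniq ?iota_uniq// => i j /invr_inj/eqP.
  by rewrite eqr_nat => /eqP[].
- by rewrite size_map size_iota.
Qed.

(** A rational function is determined by its values on the disc, which is
    infinite. *)
Lemma ratfun_eq_on_disc f p q : q != 0 -> (forall z, unit_disc z -> q.[z] != 0) ->
  (forall z, unit_disc z -> ratval f z = p.[z] / q.[z]) ->
  f = toratfun p / toratfun q.
Proof.
move=> q0 qD; elim/fraction_ind: f => P Q Q0 h.
apply/eq_fraction => //; apply/eqP; rewrite -subr_eq0; apply/eqP.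
suff : (P * q - p * Q) * Q = 0.
  by move/eqP; rewrite mulf_eq0 (negbTE Q0) orbF => /eqP.
apply: poly_zero_on_disc => z zD; rewrite hornerM.
have [->|Qz] := eqVneq Q.[z] 0; first by rewrite mulr0.
have := h z zD; rewrite ratval_fraction // => /eqP; rewrite eqr_div ?qD// => /eqP e.
by rewrite !(hornerD, hornerN, hornerM) e subrr mul0r.
Qed.

Section Orthogonal.
Variables (mu : probability (borelC R) R) (beta : nat -> R[i]) (m : nat).
Hypothesis betaD : forall k, unit_disc (beta k).
Variables (F : R[i] -> R[i]) (phi psi : ratfun R).
Hypothesis FC : C_function F.
Hypothesis Fmu : Riesz_Herglotz mu (beta 0%N) F.
Hypothesis phiL : nested_space beta m phi.
Hypothesis phi_orth : orthogonal_to mu phi (nested_space beta (m%:Z - 1)).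
Hypothesis psi2 : second_kind mu (beta 0%N) phi psi.
Local Notation s := (points beta m).
Local Notation Z := (zeros [seq beta i | i <- iota 0 m]).

Lemma points_disc k : forall b, b \in points beta k -> unit_disc b.
Proof. by move=> b /mapP[j _ ->]. Qed.

Lemma circle_neq_disc t b : `|t| = 1 -> unit_disc b -> t - b != 0.
Proof.
move=> t1 bD; rewrite subr_eq0; apply: contraTneq bD => <-.
by rewrite /unit_disc /= t1 ltxx.
Qed.

Lemma zeros_root_circle k t : `|t| = 1 -> (zeros (points beta k)).[t] != 0.
Proof.
move=> t1; rewrite horner_prod prodf_seq_neq0; apply/allP => b /points_disc bD /=.
by rewrite hornerXsubC circle_neq_disc.
Qed.

(** The first bound says that phi F + psi vanishes at beta_0, ..., beta_(m-1): on
    the disc it is the transform of phi by the Cauchy kernel, so this is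
    orthogonality.  The second one is the analogue for the superstar conjugates.
    It needs the values of psi at 1 / conj z, which lie outside the disc, hence
    the formula for the numerator of psi valid on both sides of the circle. *)
Lemma interpolation : exists p r : {poly R[i]},
  [/\ (size p <= m.+1)%N, (size r <= m.+1)%N,
      phi = toratfun p / toratfun (poles s) /\ psi = toratfun r / toratfun (poles s),
      bigO_disc (fun z => p.[z] * F z + r.[z]) (horner Z) &
      bigO_disc (fun z => (reversal m p).[z] * F z - (reversal m r).[z]) (horner Z)].
Proof.
have sD := @points_disc m; have b0 := betaD 0%N.
have ss : size s = m by rewrite size_map size_iota.
have [p sp phiE] := (ratspaceP _ _).1 phiL; rewrite ss in sp.
set q := poles s in phiE *; have q0 : q != 0 by exact: poles_neq0.
have qD (z : R[i]) : `|z| <= 1 -> q.[z] != 0 by move=> z1; exact: poles_root_disc.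
have sq : (size q <= m.+1)%N by rewrite -ss size_poles.
pose h t := p.[t] / q.[t].
have rh : regular_on_circle h := regularM (regular_poly p) (regular_inv_poles sD).
have hE (t : R[i]) : `|t| = 1 -> h t * q.[t] = p.[t] by move=> t1; rewrite divfK ?qD ?t1.
have phih (t : R[i]) : `|t| = 1 -> ratval phi t = h t.
  by move=> t1; rewrite phiE ratval_fraction ?qD ?t1.
pose Phi w := circle_int mu (fun t => h t * cauchy_kernel (beta 0%N) t w).
pose E w := circle_int mu (fun t => cauchy_kernel (beta 0%N) t w - 1).
have [r sr rE] := second_kind_numerator mu b0 sp sq rh hE.
have FE z : unit_disc z -> F z = E z.
  move=> zD; rewrite (Fmu.2 z zD); apply: eq_circle_int => t t1.
  by rewrite D0_cauchy_kernel.
have z1 (z : R[i]) : unit_disc z -> `|z| != 1 by move=> zD; rewrite lt_eqF.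
have psiE : psi = toratfun r / toratfun q.
  apply: ratfun_eq_on_disc => // z zD; first by rewrite qD// ltW.
  have qz : q.[z] != 0 by rewrite qD// ltW.
  rewrite psi2// rE ?z1// phiE ratval_fraction// -phiE.
  have rk := regular_cauchy_kernel (beta 0%N) (z1 z zD).
  have rk1 := regularD rk (regular_cst (-1)).
  have rhk := regularM rh rk.
  transitivity (Phi z - p.[z] / q.[z] * E z); last first.
    by rewrite -/(Phi z) -/(E z) mulrBl [q.[z] * _]mulrC mulfK// mulrAC.
  have -> : LF mu phi = circle_int mu h by exact: eq_circle_int.
  rewrite -(circle_intZ mu _ rk1) -circle_intB//; last first.
    exact: regularM (regular_cst _) rk1.
  rewrite -circle_intD//; last first.
    have r1 : regular_on_circle
        (fun t => (cauchy_kernel (beta 0%N) t z - 1) * (h t - p.[z] / q.[z])).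
      exact: regularM rk1 (regularD rh (regular_cst _)).
    by apply: (eq_regular _ r1) => t t1; rewrite D0_cauchy_kernel// phih.
  apply: eq_circle_int => t t1; rewrite D0_cauchy_kernel// phih//.
  by move: (cauchy_kernel _ _ _) (h t) (_ / _) => x y w; ring.
exists p, r; split=> //.
- have e (z : R[i]) : unit_disc z -> q.[z] * Phi z = p.[z] * F z + r.[z].
    by move=> zD; rewrite rE ?z1// FE// subrKC.
  have [m0|m_gt0] := posnP m.
    have -> : horner Z = fun=> 1.
      by apply/funext => z; rewrite m0 /zeros big_nil hornerC.
    apply: bigOD; last exact: bigO_poly.
    by apply: bigOMl; [exact: bigO_poly|exact: holomorphic_bigO FC.1].
  apply: (eq_bigO (f := fun z => q.[z] * Phi z)) => [z zD _|]; first exact: e.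
  apply: bigOMl; first exact: bigO_poly.
  pose s' := points beta m.-1; have s'D := @points_disc m.-1.
  have -> : Z = zeros (beta 0%N :: s') by rewrite -{1}(prednK m_gt0).
  apply: orthogonal_transform_bigO => // U sU.
  have k0 : poles s' != 0 by exact: poles_neq0.
  pose g := toratfun (reversal (size s') U) / toratfun (poles s').
  have gL : nested_space beta (m%:Z - 1) g.
    have -> : m%:Z - 1 = m.-1%:Z by rewrite -{1}(prednK m_gt0) -addn1 PoszD addrK.
    by apply/ratspaceP; exists (reversal (size s') U) => //; exact: size_reversal.
  rewrite -(phi_orth gL) /LF; apply: eq_circle_int => t t1.
  rewrite phiE /g substar_ratspace ?size_reversal// reversalK//.
  have zt : (zeros s').[t] != 0 by exact: zeros_root_circle.
  rewrite [X in ratval X]mulf_div -!tofracM ratval_fraction ?hornerM ?mulf_neq0 ?qD ?t1//.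
  by rewrite /h mulf_div.
- have Zs : zeros s * ('X - (beta 0%N)%:P) = Z * ('X - (beta m)%:P).
    rewrite mulrC -[LHS](big_cons _ _ _ _ xpredT).
    rewrite -[_ :: s]/([seq beta i | i <- iota 0 m.+1]) -addn1 iotaD map_cat.
    by rewrite /zeros big_cat big_seq1.
  have h1 := bigOM (bigO_refl (horner (zeros s))) (reflected_transform_bigO mu b0 rh).
  have h2 := bigOMl (bigO_poly (-1)%:P) h1.
  apply: (bigO_trans (bigO_poly ('X - (beta m)%:P))).
  have -> : (fun z => Z.[z] * ('X - (beta m)%:P).[z]) =
            (fun z => (zeros s).[z] * ('X - (beta 0%N)%:P).[z]).
    by apply/funext => z; rewrite -!hornerM Zs.
  apply: eq_bigO h2 => z zD z0; rewrite -/(Phi _); set w := (z^*)%C^-1.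
  have w1 : `|w| != 1 by rewrite normfV normcJ invr_eq1 z1.
  have cE : ((E w)^*)%C = - F z.
    rewrite FE// /E -circle_int_conj; last first.
      exact: regularD (regular_cauchy_kernel _ w1) (regular_cst (-1)).
    rewrite -[- circle_int _ _]mulN1r -circle_intZ; last first.
      exact: regularD (regular_cauchy_kernel _ (z1 z zD)) (regular_cst (-1)).
    apply: eq_circle_int => t t1; rewrite conjcB cauchy_kernel_conj// conjc1.
    by move: (cauchy_kernel _ _ _) => x; ring.
  rewrite -(reversal_poles s) ss !horner_reversal// -/w rE// conjcB !conjcM.
  rewrite -/(Phi w) -/(E w) cE hornerC -/q.
  move: ((q.[w])^*)%C ((p.[w])^*)%C ((Phi w)^*)%C => x y t; ring.
Qed.

End Orthogonal.
End Interpolation.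

(** * The transformed functions *)

Section Assembly.
Variable R : realType.
Implicit Types (s : seq R[i]) (p q u v : {poly R[i]}) (f g : ratfun R) (b : R[i]).

(** The identity p pA + r pB = p (pA - pB F) + pB (p F + r) settles the first
    divisibility.  The second follows by eliminating pA:
    pB (p pC + r pD) = pD (p pA + r pB) - p (pA pD - pB pC), with pB coprime to
    [zeros s].  The factor W clears the denominator of the Blaschke product in
    the hypothesis on pA - pB F. *)
Lemma numerators_dvd s W p r pA pB pC pD (F : R[i] -> R[i]) :
  (forall b, b \in s -> unit_disc b) ->
  bigO_disc (fun z => p.[z] * F z + r.[z]) (horner (zeros s)) ->
  bigO_disc (fun z => W.[z] * (pA.[z] - pB.[z] * F z)) (horner (zeros s)) ->
  zeros s %| pA * pD - pB * pC -> coprimep (zeros s) W -> coprimep (zeros s) pB ->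
  zeros s %| p * pA + r * pB /\ zeros s %| p * pC + r * pD.
Proof.
move=> sD hp hA hdet hW hB.
have dA : zeros s %| p * pA + r * pB.
  rewrite -(Gauss_dvdpr _ hW); apply: bigO_dvd => //.
  have h := bigOD (bigOMl (bigO_poly p) hA) (bigOMl (bigO_poly (W * pB)) hp).
  apply: eq_bigO h => z _ _; rewrite !(hornerM, hornerD).
  by move: (p.[z]) (r.[z]) (W.[z]) (pA.[z]) (pB.[z]) (F z) => *; ring.
split=> //; rewrite -(Gauss_dvdpr _ hB).
have -> : pB * (p * pC + r * pD) = pD * (p * pA + r * pB) - p * (pA * pD - pB * pC).
  by ring.
by rewrite dvdp_sub// dvdp_mull.
Qed.

Lemma superstar_ratspace s (e : R[i]) p : (forall b, b \in s -> unit_disc b) ->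
  (size p <= (size s).+1)%N ->
  superstar (ratconst e * (toratfun (zeros s) / toratfun (poles s)))
    (toratfun p / toratfun (poles s)) =
  ratconst e * (toratfun (reversal (size s) p) / toratfun (poles s)).
Proof.
move=> sD sp; rewrite /superstar substar_ratspace//; last exact: poles_neq0.
have z0 : toratfun (zeros s) != 0 by rewrite tofrac_eq0 zeros_neq0.
have aux (K : fieldType) (x z q v : K) : z != 0 -> x * (z / q) * (v / z) = x * (v / q).
  by move=> hz; rewrite -[LHS]mulrA; congr (_ * _); rewrite mulrC -mulrA mulKf.
exact: (aux _ _ _ _ _ z0).
Qed.

Lemma zeta_blaschke (beta : nat -> R[i]) N : (forall k, unit_disc (beta k)) ->
  exists2 e : R[i], e != 0 & zeta (beta 0%N) * blaschke beta (N%:Z - 1) =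
   ratconst e * (toratfun (zeros [seq beta i | i <- iota 0 N])
                 / toratfun (poles [seq beta i | i <- iota 0 N])).
Proof.
move=> bD; exists (\prod_(b <- [seq beta i | i <- iota 0 N]) Defs.eta b).
  exact: eta_prod_neq0.
rewrite -zeta_prod; last by move=> _ /mapP[j _ ->].
case: N => [|N]; last first.
  have -> : N.+1%:Z - 1 = N%:Z by rewrite -addn1 PoszD addrK.
  by rewrite blaschke_prod big_cons.
by rewrite sub0r /= big_nil divff// zeta_neq0.
Qed.

(** P_N turns the points beta_1, ..., beta_N of B_N into beta_0, ..., beta_(N-1):
    [varpis (beta N)] and one factor [varpi (beta N)] are traded for
    [varpis (beta 0)] and [varpi (beta 0)], so that c_n P_N B_N cancels exactly
    the zeros inside the disc and their reflections. *)
Lemma PN_blaschke (beta : nat -> R[i]) N : (forall k, unit_disc (beta k)) ->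
  exists2 k : R[i], k != 0 & PN beta N * blaschke beta N =
   ratconst k * (toratfun (zeros [seq beta i | i <- iota 0 N])
                 * toratfun (poles [seq beta i | i <- iota 0 N])
                 / (toratfun (poles (points beta N)) * toratfun (poles (points beta N)))).
Proof.
move=> bD; case: N => [|N].
  exists 1; first exact: oner_neq0.
  have h1 := varpi_neq0 (bD 0%N); have h2 := varpis_neq0 (beta 0%N).
  have h3 := ratconst_neq0 (ratval_varpi_neq0 (bD 0%N)).
  have aux (K : fieldType) (a v w : K) : v != 0 -> w != 0 -> a != 0 ->
      a * v * w / (a * v * w) * 1 = 1 * (1 * 1 / (1 * 1)).
    by move=> hv hw ha; rewrite !mulr1 divr1 mulr1 divff // !mulf_neq0.
  rewrite blaschke_prod /PN /zeros /poles !big_nil ratconst1 tofrac1.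
  exact: (aux _ _ _ _ h1 h2 h3).
set S := points beta N; set a := ratval (varpi (beta N.+1)) (beta N.+1).
set c := ratval (varpi (beta 0%N)) (beta 0%N).
have a0 : a != 0 := ratval_varpi_neq0 (bD N.+1).
have c0 : c != 0 := ratval_varpi_neq0 (bD 0%N).
exists (\prod_(b <- points beta N.+1) Defs.eta b * (a / c)).
  by rewrite mulf_neq0 ?eta_prod_neq0// mulf_neq0 ?invr_eq0.
rewrite /PN -/a -/c; clearbody a c.
rewrite blaschke_prod zeta_prod; last by move=> _ /mapP[j _ ->].
move: (\prod_(b <- _) _) => e.
have -> : points beta N.+1 = S ++ [:: beta N.+1].
  by rewrite /points -[X in iota 1 X]addn1 iotaD map_cat add1n.
have -> : [seq beta i | i <- iota 0 N.+1] = [:: beta 0%N] ++ S by [].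
rewrite !poles_cat !zeros_cat !tofracM.
rewrite /poles /zeros !big_seq1 -!/(varpi _) -!/(varpis _).
rewrite !ratconstM ratconstV.
have h1 := varpi_neq0 (bD N.+1); have h2 := varpis_neq0 (beta N.+1).
have h3 := ratconst_neq0 c0.
have h4 : toratfun (poles S) != 0.
  by rewrite tofrac_eq0 poles_neq0// => _ /mapP[j _ ->].
have aux (K : fieldType) (e' a' c' v0 w0 v w z q : K) :
  v != 0 -> w != 0 -> c' != 0 -> q != 0 ->
  a' * v0 * w0 / (c' * v * w) * (e' * (z * w / (q * v))) =
  e' * (a' / c') * (w0 * z * (v0 * q) / (q * v * (q * v))).
  by move=> hv hw hc hq; field; rewrite hv hw hc hq.
exact: (aux _ _ _ _ _ _ _ _ _ _ h1 h2 h3 h4).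
Qed.

Lemma mx22E (K : pzRingType) (G J H L d f g f' g' a b c e : K) :
  mx22 G J H L = d *: (mx22 f g f' g' *m mx22 a c b e) ->
  [/\ G = d * (f * a + g * b), J = d * (f * c + g * e),
      H = d * (f' * a + g' * b) & L = d * (f' * c + g' * e)].
Proof.
move=> /matrixP E; split.
- by have := E 0 0; rewrite !mxE !big_ord_recl big_ord0 !mxE /= addr0.
- by have := E 0 1; rewrite !mxE !big_ord_recl big_ord0 !mxE /= addr0.
- by have := E 1 0; rewrite !mxE !big_ord_recl big_ord0 !mxE /= addr0.
- by have := E 1 1; rewrite !mxE !big_ord_recl big_ord0 !mxE /= addr0.
Qed.

Lemma points_continue (beta0 hbeta : nat -> R[i]) N n :
  points (continue_points beta0 N hbeta) (N + n) =
  points (continue_points beta0 N hbeta) N ++ points hbeta n.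
Proof.
rewrite /points iotaD map_cat; congr (_ ++ _).
rewrite -[(1 + N)%N]addnC iotaDl -map_comp; apply/eq_in_map => j.
rewrite mem_iota => /andP[j1 _] /=; rewrite /continue_points leqNgt.
by rewrite -{1}(addn0 N) ltn_add2l j1 /= addKn.
Qed.

Lemma superstar_eigen (B f : ratfun R) (t : R[i]) : t != 0 ->
  superstar B f / f = ratconst t -> superstar B f = ratconst t * f.
Proof.
move=> t0 h; have f0 : f != 0.
  by apply: contraTneq (ratconst_neq0 t0) => f0; rewrite -h f0 invr0 mulr0 eqxx.
by rewrite -h divfK.
Qed.

End Assembly.

Section Entries.
Variable R : realType.

(** Each entry of the transformed matrix has the form of f.  Its numerator u is
    divisible by [zeros sZ * poles sZ], which division by d removes together with
    the double factor [poles sS]. *)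
Lemma transformed_entry (sZ sS sH sT : seq R[i]) (k e : R[i]) (u : {poly R[i]})
    (d f : ratfun R) :
  (forall b, b \in sZ -> unit_disc b) -> (forall b, b \in sS -> unit_disc b) ->
  k != 0 -> size sZ = size sS ->
  d = ratconst k * (toratfun (zeros sZ) * toratfun (poles sZ)
       / (toratfun (poles sS) * toratfun (poles sS))) ->
  f = d^-1 * (ratconst e * (toratfun u / (toratfun (poles (sS ++ sH))
                                          * toratfun (poles (sS ++ sT))))) ->
  (size u <= (size (sS ++ sH) + size (sS ++ sT)).+1)%N ->
  zeros sZ %| u -> zeros sZ %| reversal (size (sS ++ sH) + size (sS ++ sT)) u ->
  ratspace (sT ++ sH) f.
Proof.
move=> sZD sSD k0 sz dE fE su d1 d2.
have sM : (size (sS ++ sH) + size (sS ++ sT) =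
           size sZ + (size sZ + (size sT + size sH)))%N.
  by rewrite !size_cat sz addnACA [(size sH + _)%N]addnC -addnA.
rewrite sM in su d2; have [v sv uE] := zeros_poles_factor sZD su d1 d2.
apply/ratspaceP; exists ((e / k) *: v).
  by rewrite (leq_trans (size_scale_leq _ _))// size_cat.
have h1 : toratfun (zeros sZ) != 0 by rewrite tofrac_eq0 zeros_neq0.
have h2 : toratfun (poles sZ) != 0 by rewrite tofrac_eq0 poles_neq0.
have h3 : toratfun (poles sS) != 0 by rewrite tofrac_eq0 poles_neq0.
have h4 := ratconst_neq0 k0.
have aux (K : fieldType) (x y s h t v' e' k' : K) :
   x != 0 -> y != 0 -> s != 0 -> k' != 0 ->
   (k' * (x * y / (s * s)))^-1 * (e' * (x * y * v' / (s * h * (s * t)))) =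
   e' / k' * v' / (t * h).
  move=> hx hy hs hk; have [->|h0] := eqVneq h 0.
    by rewrite !(mulr0, mul0r, invr0).
  have [->|t0] := eqVneq t 0; first by rewrite !(mulr0, mul0r, invr0).
  by field; rewrite hx hy hs hk h0 t0.
rewrite fE dE uE -mul_polyC !poles_cat !tofracM -/(ratconst _) ratconstM ratconstV.
exact: (aux _ _ _ _ _ _ _ _ _ h1 h2 h3 h4).
Qed.

(** Conjugation inverts Blaschke products and fixes c and P, so it exchanges the
    two rows of the transformation; t is the common ratio of a coefficient to its
    superstar conjugate. *)
Lemma superstar_transform (K : fieldType) (c P BN Bh Br t f' g' A B A' B' : K) :
  c != 0 -> P != 0 -> BN != 0 -> Bh != 0 -> Br != 0 ->
  BN * Br * A' = t * A -> BN * Br * B' = - t * B ->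
  Br * Bh * ((c * P * BN^-1)^-1 * (f' * A' + g' * B')) =
  t * ((c * P * BN)^-1 * (BN * Bh * f' * A - BN * Bh * g' * B)).
Proof.
move=> c0 P0 N0 h0 r0 hA hB.
have -> : A' = t * A / (BN * Br) by rewrite -hA mulrC mulKf// mulf_neq0.
have -> : B' = - t * B / (BN * Br) by rewrite -hB mulrC mulKf// mulf_neq0.
by field; rewrite c0 P0 N0 r0.
Qed.

(** The constant e of the Blaschke product survives in the superstar conjugate, so
    a ratio t between functions becomes a ratio t / e between numerators. *)
Lemma reversal_eigen (s : seq R[i]) (e t : R[i]) (p : {poly R[i]}) (f : ratfun R) :
  (forall b, b \in s -> unit_disc b) -> (size p <= (size s).+1)%N -> e != 0 ->
  f = toratfun p / toratfun (poles s) ->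
  superstar (ratconst e * (toratfun (zeros s) / toratfun (poles s))) f
    = ratconst t * f ->
  reversal (size s) p = (t / e) *: p.
Proof.
move=> sD sp e0 ->; rewrite superstar_ratspace// !mulrA.
have h : (toratfun (poles s))^-1 != 0 by rewrite invr_eq0 tofrac_eq0 poles_neq0.
move/(mulIf h)/eqP; rewrite -!tofracM tofrac_eq !mul_polyC => /eqP eE.
by rewrite mulrC -scalerA -eE scalerA mulVf// scale1r.
Qed.

Lemma reversal_combination k l (t : R[i]) (p r x y : {poly R[i]}) :
  (size p <= k.+1)%N -> (size r <= k.+1)%N ->
  (size x <= l.+1)%N -> (size y <= l.+1)%N ->
  reversal l x = t *: x -> reversal l y = - t *: y ->
  reversal (k + l) (p * x + r * y) = t *: (reversal k p * x - reversal k r * y).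
Proof.
move=> sp sr sx sy hx hy; rewrite reversalD !reversalM// hx hy.
by rewrite scaleNr mulrN -!scalerAr scalerBr.
Qed.

Lemma combination_of_fractions (K : fieldType) (a u v x y s t : K) :
  a * (u / s) * (x / t) + a * (v / s) * (y / t) = a * ((u * x + v * y) / (s * t)).
Proof. by rewrite invfM; ring. Qed.

Lemma ratconstN (t : R[i]) : ratconst (- t) = - ratconst t.
Proof. by rewrite /ratconst polyCN tofracN. Qed.

End Entries.

Theorem theorem8 (R : realType) (N n r : nat)
    (beta0 hbeta tbeta : nat -> R[i])
    (beta0_disc : forall k, (k <= N)%N -> unit_disc (beta0 k))
    (hbeta_disc : forall k, unit_disc (hbeta k))
    (tbeta_disc : forall k, (k <= r)%N -> unit_disc (tbeta k))
    (hbeta0 : hbeta 0%N = beta0 N)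
    (beta := continue_points beta0 N hbeta)
    (F : R[i] -> R[i]) (mu : probability (borelC R) R)
    (FC : C_function F) (F1 : F (beta 0%N) = 1)
    (Fmu : Riesz_Herglotz mu (beta 0%N) F)
    (Fpos : positive_definite mu beta)
    (phi psi : ratfun R)
    (phiL : nested_space beta (N + n)%N phi) (phi0 : phi != 0)
    (phi_orth : orthogonal_to mu phi (nested_space beta ((N + n)%:Z - 1)))
    (psi2 : second_kind mu (beta 0%N) phi psi)
    (BNr := blaschke beta N * blaschke tbeta r)
    (LNr := ratspace (points beta N ++ points tbeta r))
    (A B C D : ratfun R)
    (AL : LNr A) (BL : LNr B) (CL : LNr C) (DL : LNr D)
    (Asr : self_reciprocal BNr A) (Bsr : self_reciprocal BNr B)
    (Csr : self_reciprocal BNr C) (Dsr : self_reciprocal BNr D)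
    (tauA : R[i]) (tauA_circle : unit_circle tauA)
    (tauAA : superstar BNr A / A = ratconst tauA)
    (tauAB : - (superstar BNr B / B) = ratconst tauA)
    (tauAC : - (superstar BNr C / C) = ratconst tauA)
    (tauAD : superstar BNr D / D = ratconst tauA)
    (B_neq0 : forall j : nat, (j < N)%N -> ratval B (beta j) != 0)
    (zB := zeta (beta 0%N) * blaschke beta (N%:Z - 1))
    (ABF : exists2 g : R[i] -> R[i], holomorphic_on_disc g &
       forall z, unit_disc z -> ratval A z - ratval B z * F z = ratval zB z * g z)
    (ADBC : exists2 f : R[i] -> R[i], holomorphic_on_disc f &
       forall z, unit_disc z -> ratval (A * D - B * C) z = ratval zB z * f z)
    (c : R) (c_neq0 : c != 0)
    (BNn := blaschke beta (N + n)%N)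
    (Brn := blaschke tbeta r * blaschke hbeta n)
    (Lrn := ratspace (points tbeta r ++ points hbeta n))
    (G H J K : ratfun R)
    (GHJK : mx22 G J
                 H (- K)
            = (ratconst (c%:C)%C * PN beta N * blaschke beta N)^-1 *:
              (mx22 phi psi
                    (superstar BNn phi) (- superstar BNn psi)
               *m mx22 A C
                       B D)) :
  [/\ Lrn G, Lrn H, Lrn J & Lrn K] /\
  superstar Brn G = ratconst tauA * H /\
  superstar Brn J = ratconst tauA * K.
Proof.
have bD k : unit_disc (beta k).
  by rewrite /beta /continue_points; case: leqP => [/beta0_disc|_]; [|exact: hbeta_disc].
set S := points beta N; set Sh := points hbeta n; set St := points tbeta r.
set Sz := [seq beta i | i <- iota 0 N].
have SD b : b \in S -> unit_disc b by move=> /mapP[j _ ->].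
have SzD b : b \in Sz -> unit_disc b by move=> /mapP[j _ ->].
have ShD b : b \in Sh -> unit_disc b by move=> /mapP[j _ ->].
have StD b : b \in St -> unit_disc b.
  move=> /mapP[j jr ->]; apply: tbeta_disc.
  by move: jr; rewrite mem_iota add1n ltnS => /andP[].
have SShD b : b \in S ++ Sh -> unit_disc b by rewrite mem_cat => /orP[/SD|/ShD].
have SStD b : b \in S ++ St -> unit_disc b by rewrite mem_cat => /orP[/SD|/StD].
have ptE : points beta (N + n) = S ++ Sh by exact: points_continue.
have szS : size S = N by rewrite size_map size_iota.
have szSz : size Sz = N by rewrite size_map size_iota.
have szSh : size (S ++ Sh) = (N + n)%N by rewrite size_cat !size_map !size_iota.
have tau0 : tauA != 0.
  by rewrite -normr_eq0 (tauA_circle : `|tauA| = 1) oner_eq0.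
have [p [q [sp sq [phiE psiE] hq1 hq2]]] :=
  interpolation bD FC Fmu phiL phi_orth psi2.
rewrite ptE in phiE psiE.
have [pA sA AE] := (ratspaceP _ _).1 AL; have [pB sB BE] := (ratspaceP _ _).1 BL.
have [pC sC CE] := (ratspaceP _ _).1 CL; have [pD sD DE] := (ratspaceP _ _).1 DL.
have supA := superstar_eigen tau0 tauAA; have supD := superstar_eigen tau0 tauAD.
have ntau0 : - tauA != 0 by rewrite oppr_eq0.
have supB : superstar BNr B = ratconst (- tauA) * B.
  by apply: (superstar_eigen ntau0); rewrite ratconstN -tauAB opprK.
have supC : superstar BNr C = ratconst (- tauA) * C.
  by apply: (superstar_eigen ntau0); rewrite ratconstN -tauAC opprK.
have BNE : blaschke beta N = \prod_(b <- S) zeta b by exact: blaschke_prod.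
have BtE : blaschke tbeta r = \prod_(b <- St) zeta b by exact: blaschke_prod.
have BhE : blaschke hbeta n = \prod_(b <- Sh) zeta b by exact: blaschke_prod.
have BNnE : BNn = blaschke beta N * blaschke hbeta n.
  by rewrite /BNn blaschke_prod ptE big_cat -BNE -BhE.
pose e1 := \prod_(b <- S ++ St) Defs.eta b.
have e1_neq0 : e1 != 0 by exact: eta_prod_neq0.
have BNrE : BNr = ratconst e1 * (toratfun (zeros (S ++ St)) / toratfun (poles (S ++ St))).
  by rewrite -zeta_prod// big_cat -BNE -BtE.
pose e0 := \prod_(b <- S ++ Sh) Defs.eta b.
have BNnE' : BNn =
    ratconst e0 * (toratfun (zeros (S ++ Sh)) / toratfun (poles (S ++ Sh))).
  by rewrite -zeta_prod// big_cat BNnE -BNE -BhE.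
clearbody e0 e1; set sg := tauA / e1.
have revA : reversal (size (S ++ St)) pA = sg *: pA.
  by apply: (reversal_eigen SStD sA e1_neq0 AE); rewrite -BNrE; exact: supA.
have revD : reversal (size (S ++ St)) pD = sg *: pD.
  by apply: (reversal_eigen SStD sD e1_neq0 DE); rewrite -BNrE; exact: supD.
have revB : reversal (size (S ++ St)) pB = - sg *: pB.
  rewrite /sg -mulNr.
  by apply: (reversal_eigen SStD sB e1_neq0 BE); rewrite -BNrE; exact: supB.
have revC : reversal (size (S ++ St)) pC = - sg *: pC.
  rewrite /sg -mulNr.
  by apply: (reversal_eigen SStD sC e1_neq0 CE); rewrite -BNrE; exact: supC.
set Q := poles (S ++ St) in AE BE CE DE BNrE.
have QD z : `|z| <= 1 -> Q.[z] != 0 by move=> z1; exact: poles_root_disc.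
have [e2 e2_neq0 zBE] := zeta_blaschke N bD.
rewrite -/Sz -/zB in zBE.
have WD z : `|z| <= 1 -> (poles Sz).[z] != 0 by move=> z1; exact: poles_root_disc.
have zBz z : unit_disc z -> ratval zB z = e2 * (zeros Sz).[z] / (poles Sz).[z].
  move=> zD; rewrite zBE /ratconst mulrA -tofracM ratval_fraction ?WD 1?ltW//.
  by rewrite hornerM hornerC.
have ratQ x (X : ratfun R) z : X = toratfun x / toratfun Q -> `|z| <= 1 ->
    ratval X z = x.[z] / Q.[z].
  by move=> -> z1; rewrite ratval_fraction ?QD.
(* The Blaschke product in the two analytic hypotheses has denominator [poles Sz];
   multiplying by it turns them into bounds by [zeros Sz]. *)
have hABF : bigO_disc (fun z => (poles Sz).[z] * (pA.[z] - pB.[z] * F z))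
    (horner (zeros Sz)).
  have [g gH gE] := ABF.
  have h := bigOMl (bigO_poly (e2 *: Q))
    (bigOMl (holomorphic_bigO gH) (bigO_refl (horner (zeros Sz)))).
  apply: eq_bigO h => z zD _; have zle : `|z| <= 1 by exact: ltW.
  have := gE z zD; rewrite (ratQ _ _ _ AE zle) (ratQ _ _ _ BE zle) zBz//.
  have hQ := QD z zle; have hW := WD z zle; rewrite hornerZ.
  move: (g z) (F z) (zeros Sz).[z] (poles Sz).[z] hW Q.[z] hQ pA.[z] pB.[z].
  move=> y x u w hw v hv a b E.
  have -> : w * (a - b * x) = w * v * (a / v - b / v * x) by field.
  by rewrite E; field.
have hdet : zeros Sz %| pA * pD - pB * pC.
  have [g gH gE] := ADBC.
  rewrite -(Gauss_dvdpr _ (zeros_poles_coprime SzD SzD)); apply: bigO_dvd => //.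
  have h := bigOMl (bigO_poly (e2 *: (Q * Q)))
    (bigOMl (holomorphic_bigO gH) (bigO_refl (horner (zeros Sz)))).
  apply: eq_bigO h => z zD _; have zle : `|z| <= 1 by exact: ltW.
  have := gE z zD; have hQ := QD z zle; have hW := WD z zle.
  have -> : A * D - B * C = toratfun (pA * pD - pB * pC) / toratfun (Q * Q).
    by rewrite AE BE CE DE !mulf_div -!tofracM -mulrBl -tofracB.
  rewrite ratval_fraction ?hornerM ?mulf_neq0// zBz// => E.
  have -> : (pA * pD - pB * pC).[z] =
      e2 * (zeros Sz).[z] / (poles Sz).[z] * g z * (Q.[z] * Q.[z]).
    by rewrite -E divfK// mulf_neq0.
  rewrite hornerZ hornerM.
  move: (g z) (zeros Sz).[z] (poles Sz).[z] hW Q.[z] => y u w hw v.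
  by field.
have hB : coprimep (zeros Sz) pB.
  apply: zeros_coprime => _ /mapP[j jN ->]; rewrite mem_iota add0n in jN.
  have := B_neq0 j jN; rewrite (ratQ _ _ _ BE) ?(ltW (bD j))//.
  by apply: contra => /eqP ->; rewrite mul0r.
(* phi and psi interpolate at N + n points, of which only the first N, those of
   zeta_0 B_(N-1), are cancelled by c_n P_N B_N. *)
have weaken f : bigO_disc f (horner (zeros [seq beta i | i <- iota 0 (N + n)])) ->
    bigO_disc f (horner (zeros Sz)).
  rewrite iotaD map_cat zeros_cat => h.
  apply: (bigO_trans (bigO_poly (zeros [seq beta i | i <- iota (0 + N) n]))).
  move=> a aD; have [M hM] := h a aD; exists M; apply: filterS hM => z.
  by rewrite hornerM.
set p' := reversal (N + n) p in hq2; set q' := reversal (N + n) q in hq2.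
have hq3 : bigO_disc (fun z => p'.[z] * F z + (- q').[z]) (horner (zeros Sz)).
  by apply: eq_bigO (weaken _ hq2) => z _ _; rewrite hornerN.
have hW := zeros_poles_coprime SzD SzD.
have [d1 d3] := numerators_dvd SzD (weaken _ hq1) hABF hdet hW hB.
have [d2 d4] := numerators_dvd SzD hq3 hABF hdet hW hB.
have sp' : (size p' <= (N + n).+1)%N by exact: size_reversal.
have sq' : (size q' <= (N + n).+1)%N by exact: size_reversal.
have sNq' : (size (- q') <= (N + n).+1)%N by rewrite size_polyN.
(* The reversal of a numerator of one row is a multiple of the numerator of the
   other row, hence divisible as well. *)
have dvd_rev (t : R[i]) (u v x y : {poly R[i]}) :
    (size u <= (N + n).+1)%N -> (size v <= (N + n).+1)%N ->
    (size x <= (size (S ++ St)).+1)%N -> (size y <= (size (S ++ St)).+1)%N ->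
    reversal (size (S ++ St)) x = t *: x -> reversal (size (S ++ St)) y = - t *: y ->
    zeros Sz %| reversal (N + n) u * x - reversal (N + n) v * y ->
    zeros Sz %| reversal (size (S ++ Sh) + size (S ++ St)) (u * x + v * y).
  move=> su sv sx sy hx hy d.
  by rewrite szSh (reversal_combination su sv sx sy hx hy) -mul_polyC dvdp_mull.
have size_comb (u v x y : {poly R[i]}) :
    (size u <= (N + n).+1)%N -> (size v <= (N + n).+1)%N ->
    (size x <= (size (S ++ St)).+1)%N -> (size y <= (size (S ++ St)).+1)%N ->
    (size (u * x + v * y)%R <= (size (S ++ Sh) + size (S ++ St)).+1)%N.
  move=> su sv sx sy; rewrite szSh.
  have le (a b : {poly R[i]}) : (size a <= (N + n).+1)%N ->
      (size b <= (size (S ++ St)).+1)%N ->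
      (size (a * b)%R <= (N + n + size (S ++ St)).+1)%N.
    move=> sa sb; rewrite (leq_trans (size_polyMleq _ _))// -subn1 leq_subLR add1n.
    by rewrite -addnS -addSn leq_add.
  by rewrite (leq_trans (size_polyD _ _))// geq_max !le.
have [k k0 PE] := PN_blaschke N bD.
pose d := ratconst (c%:C)%C * PN beta N * blaschke beta N.
have c0 : (c%:C)%C != 0 :> R[i].
  by rewrite -(rmorph0 (real_complex R)) (inj_eq (@complexI R)).
have dE : d = ratconst ((c%:C)%C * k) * (toratfun (zeros Sz) * toratfun (poles Sz)
     / (toratfun (poles S) * toratfun (poles S))).
  by rewrite /d -mulrA PE mulrA -ratconstM.
have ck0 : (c%:C)%C * k != 0 by rewrite mulf_neq0.
have entry := fun f e u => @transformed_entry R Sz S Sh St _ e u d f SzD SD ck0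
  (etrans szSz (esym szS)) dE.
have [GE JE HE KE] := mx22E GHJK.
have rp' : reversal (N + n) p' = p by exact: reversalK.
have rq' : reversal (N + n) (- q') = - q by rewrite reversalN reversalK.
have phiS : superstar BNn phi = ratconst e0 * (toratfun p' / toratfun (poles (S ++ Sh))).
  rewrite BNnE' phiE /p' -szSh; apply: superstar_ratspace; first exact: SShD.
  by rewrite szSh.
have psiS : superstar BNn psi = ratconst e0 * (toratfun q' / toratfun (poles (S ++ Sh))).
  rewrite BNnE' psiE /q' -szSh; apply: superstar_ratspace; first exact: SShD.
  by rewrite szSh.
have Ep : reversal (N + n) p = p' by [].
have Eq : reversal (N + n) q = q' by [].
clearbody p' q'.
have comb (a : R[i]) (u v x y : {poly R[i]}) :
    ratconst a * (toratfun u / toratfun (poles (S ++ Sh))) * (toratfun x / toratfun Q)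
    + ratconst a * (toratfun v / toratfun (poles (S ++ Sh))) * (toratfun y / toratfun Q)
    = ratconst a * (toratfun (u * x + v * y) / (toratfun (poles (S ++ Sh)) * toratfun Q)).
  by rewrite combination_of_fractions tofracD !tofracM.
have phi1 : phi = ratconst 1 * (toratfun p / toratfun (poles (S ++ Sh))).
  by rewrite ratconst1 mul1r.
have psi1 : psi = ratconst 1 * (toratfun q / toratfun (poles (S ++ Sh))).
  by rewrite ratconst1 mul1r.
have psiSN : - superstar BNn psi =
    ratconst e0 * (toratfun (- q') / toratfun (poles (S ++ Sh))).
  by rewrite psiS tofracN mulNr mulrN.
split.
  split.
  - apply: (entry G 1 (p * pA + q * pB)) => //.
    + by rewrite GE -/d phi1 psi1 AE BE comb.
    + exact: size_comb.
    + by apply: (dvd_rev sg _ _ _ _ sp sq sA sB revA revB); rewrite Ep Eq -mulNr.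
  - apply: (entry H e0 (p' * pA + - q' * pB)) => //.
    + by rewrite HE -/d phiS psiSN AE BE comb.
    + exact: size_comb.
    + by apply: (dvd_rev sg _ _ _ _ sp' sNq' sA sB revA revB);
        rewrite rp' rq' mulNr opprK.
  - apply: (entry J 1 (p * pC + q * pD)) => //.
    + by rewrite JE -/d phi1 psi1 CE DE comb.
    + exact: size_comb.
    + apply: (dvd_rev (- sg) _ _ _ _ sp sq sC sD revC); first by rewrite opprK.
      by rewrite Ep Eq -mulNr.
  - apply: (entry K (- e0) (p' * pC + - q' * pD)) => //.
    + rewrite -[K]opprK KE -/d phiS psiSN CE DE comb ratconstN.
      by rewrite -[LHS]mulrN -[in LHS]mulNr.
    + exact: size_comb.
    + apply: (dvd_rev (- sg) _ _ _ _ sp' sNq' sC sD revC); first by rewrite opprK.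
      by rewrite rp' rq' mulNr opprK.
have h1 := ratconst_neq0 c0; have h2 := PN_neq0 (bD 0%N) (bD N).
have h3 : blaschke beta N != 0 by rewrite BNE prod_zeta_neq0.
have h4 : blaschke hbeta n != 0 by rewrite BhE prod_zeta_neq0.
have h5 : blaschke tbeta r != 0 by rewrite BtE prod_zeta_neq0.
have substar_d : substar d = ratconst (c%:C)%C * PN beta N * (blaschke beta N)^-1.
  rewrite /d (substarM _ (blaschke _ _)) (substarM _ (PN _ _)).
  rewrite substar_ratconst conjc_real (substar_PN (bD 0%N) (bD N)).
  by rewrite BNE substar_prod_zeta.
have trans := fun f g X Y X' Y' t =>
  @superstar_transform (ratfun R) _ _ _ _ _ t f g X Y X' Y' h1 h2 h3 h4 h5.
rewrite -/d in GE JE HE KE.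
have d0E : d = ratconst (c%:C)%C * PN beta N * blaschke beta N by [].
clearbody d.
rewrite /superstar GE JE !substarM !substarV !substarD !substarM substar_d.
split.
  rewrite HE mulNr /superstar BNnE d0E; apply: (trans _ _ _ _ _ _ (ratconst tauA)).
    exact: supA.
  by rewrite -ratconstN; exact: supB.
have -> : ratconst tauA * K = ratconst (- tauA) *
    (d^-1 * (superstar BNn phi * C - superstar BNn psi * D)).
  by rewrite -[K]opprK KE mulrN ratconstN !mulNr.
rewrite /superstar BNnE d0E; apply: (trans _ _ _ _ _ _ (ratconst (- tauA))).
  exact: supC.
by rewrite -ratconstN opprK; exact: supD.
Qed.
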